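(* For $\mu>0$ and $n\ge 1$ let $$\beta_{\mu,n}=\min_{j_{\mu,n}<x<j_{\mu,n+1}}\left(1-\frac{J_{\mu-1}(x)J_{\mu+1}(x)}{J_\mu^2(x)}\right).$$ For every $\mu>0$ the sequence $\{\beta_{\mu,n}\}_{n\ge1}$ is strictly increasing and converges to $1$ from below; more precisely $$\frac1{\mu+1}<\beta_{\mu,1}<\beta_{\mu,2}<\ldots<\beta_{\mu,n}<\beta_{\mu,n+1}<\ldots<1,\qquad \lim_{n\to\infty}\beta_{\mu,n}=1.$$ Consequently, for all $\mu>0$, $n\ge1$ and $x\in(j_{\mu,n},j_{\mu,n+1})$ the sharp inequality $$J_\mu^2(x)-J_{\mu-1}(x)J_{\mu+1}(x)\ge\beta_{\mu,n}\,J_\mu^2(x)$$ holds (sharp meaning that the constant $\beta_{\mu,n}$ is best possible on this interval). Moreover, for every fixed $n\ge1$, the function $\mu\mapsto\beta_{\mu,n}$ is strictly decreasing on $(0,\infty)$.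
   Context: $J_\mu$ denotes the Bessel function of the first kind of order $\mu$, and $0<j_{\mu,1}<j_{\mu,2}<\ldots$ are the positive zeros of $J_\mu$ in increasing order. The function $\Phi_\mu(x)=1-J_{\mu-1}(x)J_{\mu+1}(x)/J_\mu^2(x)$ is strictly convex on each interval $(j_{\mu,n},j_{\mu,n+1})$ and tends to $+\infty$ at both endpoints, so it attains its minimum there at a unique point. *)

(* Defs.v *)
(* Stdlib real numbers with Coquelicot. *)
From Stdlib Require Import Reals Factorial Lra Lia.
From Coquelicot Require Import Coquelicot.
Open Scope R_scope.

(* Euler's integral, improper at both ends; meaningful for s > 0. *)
Definition Gamma (s : R) : R :=
  RInt_gen (fun t : R => Rpower t (s - 1) * exp (- t))
           (at_right 0) (Rbar_locally p_infty).

(* Meaningful for mu > -1 and x > 0: then every Gamma value is taken at a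
   positive argument.  Only such orders and arguments occur below. *)
Definition BesselJ (mu x : R) : R :=
  Series (fun k : nat =>
    (-1) ^ k / (INR (fact k) * Gamma (mu + INR k + 1))
    * Rpower (x / 2) (2 * INR k + mu)).

(* The n-th positive zero of f, counted from n = 1, with the convention that
   the 0-th one is 0.  It is the usual enumeration when the positive zeros of f
   form an infinite set without accumulation point in [0, oo); see
   [pos_zero_enum]. *)
Fixpoint pos_zero (f : R -> R) (n : nat) : R :=
  match n with
  | O => 0
  | S m => real (Glb_Rbar (fun x : R => pos_zero f m < x /\ f x = 0))
  end.

Lemma pos_zero_enum (f : R -> R) (z : nat -> R) :
  z O = 0 ->
  (forall n : nat, z n < z (S n)) ->
  (forall x : R, 0 < x ->
     (f x = 0 <-> exists n : nat, (1 <= n)%nat /\ x = z n)) ->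
  forall n : nat, pos_zero f n = z n.
Proof.
intros z0 zinc zP.
assert (zmon : forall m k, z m <= z (m + k)%nat).
{ intros m k; induction k as [|k IH].
  - rewrite Nat.add_0_r; lra.
  - rewrite Nat.add_succ_r; specialize (zinc (m + k)%nat); lra. }
assert (zle : forall m n, (m <= n)%nat -> z m <= z n).
{ intros m n H; replace n with (m + (n - m))%nat by lia; apply zmon. }
induction n as [|n IH]; simpl.
- now symmetry.
- rewrite IH.
  rewrite (is_glb_Rbar_unique _ (Finite (z (S n)))); [reflexivity|].
  assert (zn : 0 <= z n) by (rewrite <- z0; apply zle; lia).
  split.
  + intros x [Hx fx]; simpl.
    apply zP in fx; [|lra]; destruct fx as [m [_ ->]].
    destruct (Nat.le_gt_cases m n) as [H|H].
    * specialize (zle _ _ H); lra.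
    * apply zle; lia.
  + intros b Hb; apply Hb; split; [apply zinc|].
    apply zP; [specialize (zinc n); lra|].
    exists (S n); split; [lia|reflexivity].
Qed.

Definition bessel_zero (mu : R) (n : nat) : R := pos_zero (BesselJ mu) n.

Definition Phi (mu x : R) : R :=
  1 - BesselJ (mu - 1) x * BesselJ (mu + 1) x / (BesselJ mu x) ^ 2.

Definition zero_interval (mu : R) (n : nat) (x : R) : Prop :=
  bessel_zero mu n < x < bessel_zero mu (S n).

(* The minimum is encoded as an infimum, which makes it a total function; that
   it is attained has to be stated separately. *)
Definition beta (mu : R) (n : nat) : R :=
  real (Glb_Rbar (fun y : R =>
    exists x : R, zero_interval mu n x /\ y = Phi mu x)).

(* Main.v *)
(** Write [y = J_mu], [q = x y' / y] and [e = (x y')^2 + (x^2 - mu^2) y^2].  Then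
    [Phi = 1 + (q^2 - mu^2) / x^2 = e / (x y)^2], and [e > 0] because [e] vanishes
    at [0] and [e' = 2 x y^2].  At a critical point of [Phi] one gets
    [Phi = 1 / (1 + q)], hence [q x^2 = (mu^2 - q^2) (1 + q)] with [0 < q < mu].
    There [x] determines [q] as a decreasing function, which gives the bounds, the
    monotonicity in [n] and the limit.

    For the monotonicity in [mu] put [s = x / mu], [u = y] and [v = x y' / mu], so
    that [p = v / u = q / mu] solves [s p' = - mu (p^2 + s^2 - 1)], the factor in
    brackets being positive.  A Sturm comparison therefore shows that [p]
    decreases in [mu] at fixed [s], and that so do the rescaled zeros [j / mu].
    At the minimiser [s] for the smaller order, the larger order either has [|p|]
    smaller, hence a smaller [Phi = 1 + (p^2 - 1) / s^2], or it has already passed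
    a zero of [v], where [Phi = 1 - 1 / s^2] is smaller as well. *)

Require Import Defs.
From Stdlib Require Import Reals Factorial Lra Lia.
From Coquelicot Require Import Coquelicot.
Open Scope R_scope.

(** * Real analysis *)

Lemma is_derive_continuity_pt (f : R -> R) (x l : R) :
  is_derive f x l -> continuity_pt f x.
Proof.
intros H; apply derivable_continuous_pt; exists l; now apply is_derive_Reals.
Qed.

Lemma pow2_pos (x : R) : x <> 0 -> 0 < x ^ 2.
Proof. intros Hx; rewrite <- Rsqr_pow2; now apply Rsqr_pos_lt. Qed.

Lemma derive_pos_lt (f df : R -> R) (a b : R) :
  a < b ->
  (forall x, a <= x <= b -> is_derive f x (df x)) ->
  (forall x, a < x < b -> 0 < df x) ->
  f a < f b.
Proof.
intros Hab Hd Hp.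
destruct (MVT_cor2 f df a b Hab) as (c & Hc & Hc').
- intros c Hc; now apply is_derive_Reals, Hd.
- specialize (Hp c Hc'); nra.
Qed.

Lemma derive_nonneg_le (f df : R -> R) (a b : R) :
  a <= b ->
  (forall x, a <= x <= b -> is_derive f x (df x)) ->
  (forall x, a < x < b -> 0 <= df x) ->
  f a <= f b.
Proof.
intros Hab Hd Hp; destruct (Rle_lt_or_eq_dec a b Hab) as [Hlt|<-]; [|lra].
destruct (MVT_cor2 f df a b Hlt) as (c & Hc & Hc').
- intros c Hc; now apply is_derive_Reals, Hd.
- specialize (Hp c Hc'); nra.
Qed.

Lemma derive_pos_lim_0_pos (f df : R -> R) (a b : R) :
  a < b ->
  filterlim f (at_right a) (locally 0) ->
  (forall x, a < x <= b -> is_derive f x (df x)) ->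
  (forall x, a < x < b -> 0 < df x) ->
  0 < f b.
Proof.
intros Hab Hlim Hd Hp.
assert (Hmon : forall x y, a < x -> x < y -> y <= b -> f x < f y).
{ intros x y Hx Hxy Hy; apply derive_pos_lt with df; [easy| |].
  - intros; apply Hd; lra.
  - intros; apply Hp; lra. }
apply Rnot_le_lt; intros Hb.
set (c := (a + b) / 2).
assert (Hc : f c < f b) by (apply Hmon; unfold c; lra).
assert (He : 0 < - f c) by lra.
destruct (Hlim (fun z => Rabs z < - f c)) as [d Hd'].
- exists (mkposreal _ He); intros z Hz.
  change (Rabs (z - 0) < - f c) in Hz; now rewrite Rminus_0_r in Hz.
- set (x := a + Rmin d (c - a) / 2).
  assert (Hm : 0 < Rmin d (c - a)).
  { apply Rmin_pos; [apply cond_pos|unfold c; lra]. }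
  assert (Hm1 := Rmin_l d (c - a)); assert (Hm2 := Rmin_r d (c - a)).
  assert (Hx : Rabs (f x) < - f c).
  { apply Hd'; [|unfold x; lra].
    change (Rabs (x - a) < d); unfold x; rewrite Rabs_right; lra. }
  apply Rabs_def2 in Hx.
  assert (f x < f c); [|lra].
  apply Hmon; unfold x, c in *; lra.
Qed.

Lemma no_zero_same_sign (f : R -> R) (a b : R) :
  a <= b ->
  (forall x, a <= x <= b -> continuity_pt f x) ->
  (forall x, a <= x <= b -> f x <> 0) ->
  0 < f a * f b.
Proof.
intros Hab Hc Hn.
assert (Ha := Hn a ltac:(lra)); assert (Hb := Hn b ltac:(lra)).
destruct (Rle_lt_or_eq_dec a b Hab) as [Hlt|<-]; [|nra].
destruct (Rtotal_order (f a) 0) as [H1|[H1|H1]]; [|lra|];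
destruct (Rtotal_order (f b) 0) as [H2|[H2|H2]]; try lra; try nra.
- destruct (Ranalysis5.IVT_interv f a b Hc Hlt H1 H2) as (z & Hz & Hz').
  now destruct (Hn z Hz).
- destruct (Ranalysis5.IVT_interv (fun x => - f x) a b) as (z & Hz & Hz'); try lra.
  + intros x Hx; apply continuity_pt_opp; now apply Hc.
  + destruct (Hn z Hz); lra.
Qed.

Lemma is_derive_isolated_zero (f : R -> R) (a l : R) :
  is_derive f a l -> f a = 0 -> l <> 0 ->
  exists d, 0 < d /\ forall x, x <> a -> Rabs (x - a) < d -> f x <> 0.
Proof.
intros Hd Ha Hl; apply is_derive_Reals in Hd.
destruct (Hd (Rabs l)) as [d Hd']; [now apply Rabs_pos_lt|].
exists d; split; [apply cond_pos|]; intros x Hx Hxd Hf.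
specialize (Hd' (x - a) ltac:(lra) Hxd).
replace (a + (x - a)) with x in Hd' by ring; rewrite Hf, Ha in Hd'.
replace ((0 - 0) / (x - a) - l) with (- l) in Hd' by (field; lra).
rewrite Rabs_Ropp in Hd'; lra.
Qed.

Lemma pos_zero_spec (f : R -> R) :
  (forall x, 0 < x -> continuity_pt f x) ->
  (forall a, exists x, a < x /\ f x = 0) ->
  (forall a, a = 0 \/ (0 < a /\ f a = 0) ->
     exists d, 0 < d /\ forall x, a < x < a + d -> f x <> 0) ->
  forall n, 0 <= pos_zero f n < pos_zero f (S n) /\ f (pos_zero f (S n)) = 0 /\
    forall x, pos_zero f n < x < pos_zero f (S n) -> f x <> 0.
Proof.
intros Hc Hu Hi.
assert (Step : forall n,
    pos_zero f n = 0 \/ (0 < pos_zero f n /\ f (pos_zero f n) = 0) ->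
  pos_zero f n < pos_zero f (S n) /\ f (pos_zero f (S n)) = 0 /\
    forall x, pos_zero f n < x < pos_zero f (S n) -> f x <> 0).
{ intros n Hn; simpl; set (a := pos_zero f n) in *.
  destruct (Hi a Hn) as (d & Hd & Hi').
  destruct (Hu a) as (w & Hw & Hfw).
  destruct (Glb_Rbar_correct (fun x => a < x /\ f x = 0)) as [H1 H2].
  set (g := Glb_Rbar (fun x => a < x /\ f x = 0)) in *.
  assert (Hlow : Rbar_le (a + d) g).
  { apply H2; intros x [Hx Hfx]; simpl; apply Rnot_lt_le; intros Hx'.
    now apply (Hi' x). }
  assert (Hup := H1 w (conj Hw Hfw)).
  destruct g as [g| |]; simpl in *; try easy.
  assert (Hbelow : forall x, a < x < g -> f x <> 0).
  { intros x Hx Hfx; specialize (H1 x (conj (proj1 Hx) Hfx)); simpl in H1; lra. }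
  split; [lra|]; split; [|exact Hbelow].
  assert (Ha : 0 <= a) by lra.
  assert (Hg : 0 < g) by lra.
  apply Classical_Prop.NNPP; intros Hfg.
  destruct (Hc g Hg (Rabs (f g))) as (e & He & Hcont); [now apply Rabs_pos_lt|].
  simpl in Hcont; unfold R_dist in Hcont.
  assert (g + e <= g); [|lra].
  apply (H2 (Finite (g + e))); intros x [Hx Hfx]; simpl.
  apply Rnot_lt_le; intros Hxe.
  assert (Hxg : g <= x) by (apply (H1 x (conj Hx Hfx))).
  destruct (Req_dec g x) as [->|Hne]; [easy|].
  assert (H := Hcont x); rewrite Hfx, Rminus_0_l, Rabs_Ropp in H.
  assert (Rabs (f g) < Rabs (f g)); [|lra].
  apply H; split; [split; [exact I|exact Hne]|].
  rewrite Rabs_right; lra. }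
assert (Hz : forall n, pos_zero f n = 0 \/ (0 < pos_zero f n /\ f (pos_zero f n) = 0)).
{ induction n as [|n IH]; [now left|right].
  destruct (Step n IH) as (H1 & H2 & _); split; [|easy].
  destruct IH as [IH|IH]; lra. }
intros n; destruct (Step n (Hz n)) as (H1 & H2 & H3).
repeat split; try easy; destruct (Hz n) as [H|H]; lra.
Qed.

(** * The Gamma function *)

Lemma is_derive_value (f : R -> R) (x l l' : R) :
  l' = l -> is_derive f x l' -> is_derive f x l.
Proof. now intros ->. Qed.

Lemma is_RInt_gen_nonneg_bounded (f : R -> R) (M : R) :
  (forall t, 0 < t -> continuous f t) ->
  (forall t, 0 < t -> 0 <= f t) ->
  (forall a b, 0 < a -> a <= b -> RInt f a b <= M) ->
  exists l, is_RInt_gen f (at_right 0) (Rbar_locally p_infty) l /\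
    forall a b, 0 < a -> a <= b -> RInt f a b <= l.
Proof.
intros Hc Hp HM.
assert (Hex : forall a b, 0 < a -> a <= b -> ex_RInt f a b).
{ intros a b Ha Hab; apply (ex_RInt_continuous (V := R_CompleteNormedModule)).
  intros z Hz; apply Hc.
  rewrite Rmin_left in Hz by lra; lra. }
destruct (completeness (fun v => exists a b, 0 < a /\ a <= b /\ v = RInt f a b))
  as [l [Hl1 Hl2]].
- exists M; intros v (a & b & Ha & Hab & ->); now apply HM.
- exists (RInt f 1 1), 1, 1; repeat split; lra.
- exists l; split.
  + intros P [eps Heps].
    assert (H : exists a b, 0 < a /\ a <= b /\ l - eps < RInt f a b).
    { apply Classical_Prop.NNPP; intros H.
      assert (l <= l - eps); [|destruct eps; simpl in *; lra].
      apply Hl2; intros v (a & b & Ha & Hab & ->).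
      apply Rnot_lt_le; intros H'; apply H; exists a, b; auto. }
    destruct H as (a0 & b0 & Ha0 & Hab0 & Hlt).
    apply Filter_prod with (Q := fun a => 0 < a < a0) (R := fun b => b0 < b).
    * exists (mkposreal a0 Ha0); intros y Hy Hy'; split; [easy|].
      change (Rabs (y - 0) < a0) in Hy; apply Rabs_def2 in Hy; lra.
    * exists b0; auto.
    * intros a b Ha Hb; exists (RInt f a b); split; simpl.
      -- apply (RInt_correct (V := R_CompleteNormedModule)), Hex; lra.
      -- apply Heps; change (Rabs (RInt f a b - l) < eps).
         assert (RInt f a b <= l) by (apply Hl1; exists a, b; repeat split; lra).
         assert (RInt f a0 b0 <= RInt f a b).
         { rewrite <- (RInt_Chasles f a a0 b) by (apply Hex; lra).
           rewrite <- (RInt_Chasles f a0 b0 b) by (apply Hex; lra).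
           assert (0 <= RInt f a a0).
           { apply RInt_ge_0; [lra|apply Hex; lra|]; intros; apply Hp; lra. }
           assert (0 <= RInt f b0 b).
           { apply RInt_ge_0; [lra|apply Hex; lra|]; intros; apply Hp; lra. }
           unfold plus; simpl; lra. }
         rewrite Rabs_left1 by lra; lra.
  + intros a b Ha Hab; apply Hl1; exists a, b; auto.
Qed.

(* Tangent line of [ln] at [s + 1]. *)
Lemma exp_opp_le_Rpower (s t : R) :
  0 < s -> 0 < t ->
  exp (- t) <= exp ((s + 1) * ln (s + 1) - s) * Rpower (1 + t) (- (s + 1)).
Proof.
intros Hs Ht; unfold Rpower; rewrite <- exp_plus.
assert (Hln : ln (1 + t) <= ln (s + 1) + ((1 + t) / (s + 1) - 1)).
{ replace (1 + t) with ((s + 1) * ((1 + t) / (s + 1))) at 1 by (field; lra).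
  assert (0 < (1 + t) / (s + 1)) by (apply Rdiv_lt_0_compat; lra).
  rewrite ln_mult by lra.
  apply Rplus_le_compat_l.
  generalize (exp_ineq1_le (ln ((1 + t) / (s + 1)))).
  rewrite exp_ln by assumption; lra. }
assert ((s + 1) * ln (1 + t) <= (s + 1) * (ln (s + 1) + ((1 + t) / (s + 1) - 1)))
  by (apply Rmult_le_compat_l; lra).
replace ((s + 1) * (ln (s + 1) + ((1 + t) / (s + 1) - 1)))
  with ((s + 1) * ln (s + 1) + t - s) in H by (field; lra).
destruct (Req_dec (- t)
  ((s + 1) * ln (s + 1) - s + - (s + 1) * ln (1 + t))) as [E|E].
- rewrite E at 1; lra.
- left; apply exp_increasing; lra.
Qed.

Definition gamma_integrand (s t : R) : R := Rpower t (s - 1) * exp (- t).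

Lemma is_derive_Rpower (a t : R) :
  0 < t -> is_derive (fun t => Rpower t a) t (a * Rpower t (a - 1)).
Proof.
intros Ht; apply is_derive_Reals; now apply derivable_pt_lim_power.
Qed.

Lemma continuous_gamma_integrand (s t : R) :
  0 < t -> continuous (gamma_integrand s) t.
Proof.
intros Ht; apply (continuous_mult (K := R_AbsRing)).
- apply (ex_derive_continuous (V := R_NormedModule)).
  eexists; now apply is_derive_Rpower.
- apply (ex_derive_continuous (V := R_NormedModule)); auto_derive; auto.
Qed.

Lemma RInt_gamma_integrand_le (s a b : R) :
  0 < s -> 0 < a -> a <= b ->
  RInt (gamma_integrand s) a b <= exp ((s + 1) * ln (s + 1) - s) / s.
Proof.
intros Hs Ha Hab.
set (C := exp ((s + 1) * ln (s + 1) - s)).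
assert (HC : 0 < C) by apply exp_pos.
set (F := fun t => C / s * Rpower (t / (1 + t)) s).
set (g := fun t => C * (Rpower (t / (1 + t)) (s - 1) * / (1 + t) ^ 2)).
assert (HF : is_RInt g a b (minus (F b) (F a))).
{ apply (is_RInt_derive F g).
  - intros x; rewrite Rmin_left, Rmax_right by lra; intros Hx.
    assert (Hd : is_derive (fun t => t / (1 + t)) x (/ (1 + x) ^ 2)).
    { auto_derive; [lra|]; field; lra. }
    assert (Hp : 0 < x / (1 + x)) by (apply Rdiv_lt_0_compat; lra).
    assert (Hq := is_derive_comp (fun u => Rpower u s) (fun t => t / (1 + t)) x
      _ _ (is_derive_Rpower s _ Hp) Hd).
    apply (is_derive_scal _ _ (C / s)) in Hq.
    unfold F; eapply is_derive_value; [|exact Hq].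
    unfold g, scal; simpl; unfold mult; simpl; field; split; lra.
  - intros x; rewrite Rmin_left, Rmax_right by lra; intros Hx.
    assert (Hp : 0 < x / (1 + x)) by (apply Rdiv_lt_0_compat; lra).
    apply (ex_derive_continuous (V := R_NormedModule) g); unfold g.
    apply (ex_derive_scal (fun t => Rpower (t / (1 + t)) (s - 1) * / (1 + t) ^ 2)).
    apply (ex_derive_mult (fun t => Rpower (t / (1 + t)) (s - 1))
            (fun t => / (1 + t) ^ 2)).
    + apply (ex_derive_comp (fun u => Rpower u (s - 1)) (fun t => t / (1 + t))).
      * eexists; now apply is_derive_Rpower.
      * auto_derive; lra.
    + auto_derive; apply Rgt_not_eq; nra. }
assert (H1 : RInt (gamma_integrand s) a b <= minus (F b) (F a)).
{ refine (is_RInt_le _ _ a b _ _ Hab (RInt_correct _ _ _ _) HF _).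
  - apply (ex_RInt_continuous (V := R_CompleteNormedModule)); intros z Hz.
    rewrite Rmin_left in Hz by lra; apply continuous_gamma_integrand; lra.
  - intros x Hx; unfold gamma_integrand, g.
    assert (Hp : 0 < x / (1 + x)) by (apply Rdiv_lt_0_compat; lra).
    apply Rle_trans with (Rpower x (s - 1) * (C * Rpower (1 + x) (- (s + 1)))).
    + apply Rmult_le_compat_l; [left; apply exp_pos|].
      apply exp_opp_le_Rpower; lra.
    + right.
      replace (Rpower x (s - 1))
        with (Rpower (x / (1 + x)) (s - 1) * Rpower (1 + x) (s - 1)).
      * replace (/ (1 + x) ^ 2)
          with (Rpower (1 + x) (s - 1) * Rpower (1 + x) (- (s + 1))).
        ring.
        rewrite <- Rpower_plus.
        replace (s - 1 + - (s + 1)) with (- INR 2) by (simpl; ring).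
        rewrite Rpower_Ropp, Rpower_pow by lra; reflexivity.
      * rewrite Rpower_mult_distr by lra; f_equal; field; lra. }
assert (H2 : 0 <= F a).
{ unfold F; apply Rmult_le_pos; [|left; apply exp_pos].
  left; now apply Rdiv_lt_0_compat. }
assert (H3 : F b <= C / s).
{ unfold F; rewrite <- (Rmult_1_r (C / s)) at 2.
  apply Rmult_le_compat_l; [left; now apply Rdiv_lt_0_compat|].
  assert (H1s : Rpower 1 s = 1)
    by (unfold Rpower; rewrite ln_1, Rmult_0_r; apply exp_0).
  apply Rle_trans with (Rpower 1 s); [|lra].
  assert (0 < b / (1 + b)) by (apply Rdiv_lt_0_compat; lra).
  apply Rle_Rpower_l; [lra|]; split; [easy|].
  apply Rle_div_l; lra. }
unfold minus, plus, opp in H1; simpl in H1; lra.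
Qed.

Lemma is_RInt_gen_Gamma (s : R) :
  0 < s ->
  is_RInt_gen (gamma_integrand s) (at_right 0) (Rbar_locally p_infty) (Gamma s)
  /\ RInt (gamma_integrand s) 1 2 <= Gamma s.
Proof.
intros Hs.
destruct (is_RInt_gen_nonneg_bounded (gamma_integrand s)
            (exp ((s + 1) * ln (s + 1) - s) / s)) as [l [H1 H2]].
- apply continuous_gamma_integrand.
- intros t Ht; left; apply Rmult_lt_0_compat; apply exp_pos.
- intros a b; now apply RInt_gamma_integrand_le.
- assert (E : Gamma s = l).
  { apply (is_RInt_gen_unique (gamma_integrand s)); exact H1. }
  rewrite E; split; [exact H1|apply H2; lra].
Qed.

Lemma Gamma_pos (s : R) : 0 < s -> 0 < Gamma s.
Proof.
intros Hs; apply Rlt_le_trans with (2 := proj2 (is_RInt_gen_Gamma s Hs)).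
apply RInt_gt_0; [lra| |].
- intros; apply Rmult_lt_0_compat; apply exp_pos.
- intros x Hx; apply continuous_gamma_integrand; lra.
Qed.

Lemma filterlim_Rpower_0 (s : R) :
  0 < s -> filterlim (fun t => Rpower t s) (at_right 0) (locally 0).
Proof.
intros Hs; unfold Rpower.
apply filterlim_comp with (G := Rbar_locally m_infty).
2: exact is_lim_exp_m.
apply filterlim_comp with (1 := is_lim_ln_0).
intros P [M HM]; exists (M / s); intros x Hx; apply HM.
apply Rmult_lt_compat_l with (r := s) in Hx; [|easy].
replace (s * (M / s)) with M in Hx by (field; lra); lra.
Qed.

Lemma filterlim_Rpower_exp_opp_infty (s : R) :
  0 < s ->
  filterlim (fun t => Rpower t s * exp (- t)) (Rbar_locally p_infty) (locally 0).
Proof.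
intros Hs.
set (C := exp ((s + 1) * ln (s + 1) - s)).
apply (filterlim_le_le (fun _ => 0) _ (fun t => C * / t) 0).
- exists 0; intros t Ht; split.
  + left; apply Rmult_lt_0_compat; apply exp_pos.
  + apply Rle_trans with (Rpower (1 + t) s * (C * Rpower (1 + t) (- (s + 1)))).
    * apply Rmult_le_compat; try (left; apply exp_pos).
      -- apply Rle_Rpower_l; lra.
      -- now apply exp_opp_le_Rpower.
    * replace (Rpower (1 + t) s * (C * Rpower (1 + t) (- (s + 1))))
        with (C * (Rpower (1 + t) s * Rpower (1 + t) (- (s + 1)))) by ring.
      rewrite <- Rpower_plus; replace (s + - (s + 1)) with (Ropp 1) by ring.
      rewrite Rpower_Ropp, Rpower_1 by lra.
      apply Rmult_le_compat_l; [left; apply exp_pos|].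
      apply Rinv_le_contravar; lra.
- apply filterlim_const.
- change (is_lim (fun t => C * / t) p_infty 0).
  replace (Finite 0) with (Rbar_mult C (Rbar_inv p_infty)) by (simpl; f_equal; ring).
  apply is_lim_scal_l, is_lim_inv; [apply is_lim_id|easy].
Qed.

Lemma Gamma_succ (s : R) : 0 < s -> Gamma (s + 1) = s * Gamma s.
Proof.
intros Hs.
set (F := fun t => Rpower t s * exp (- t)).
set (dF := fun t => s * gamma_integrand s t - gamma_integrand (s + 1) t).
assert (HF : forall t, 0 < t -> is_derive F t (dF t)).
{ intros t Ht.
  assert (He : is_derive (fun t => exp (- t)) t (- exp (- t)))
    by (auto_derive; [easy|ring]).
  assert (H := is_derive_mult (fun t => Rpower t s) _ t _ _
    (is_derive_Rpower s t Ht) He Rmult_comm).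
  eapply is_derive_value; [|exact H].
  unfold dF, gamma_integrand, plus, mult; simpl.
  replace (s + 1 - 1) with s by ring; ring. }
assert (HD : forall t, 0 < t -> Derive F t = dF t)
  by (intros; now apply is_derive_unique, HF).
assert (Hpos : filter_prod (at_right 0) (Rbar_locally p_infty)
   (fun ab : R * R => 0 < fst ab /\ 0 < snd ab)).
{ apply Filter_prod with (Q := fun a => 0 < a) (R := fun b => 0 < b); auto.
  - exists (mkposreal 1 Rlt_0_1); auto.
  - exists 0; auto. }
assert (Hmin : forall a b : R, 0 < a -> 0 < b -> 0 < Rmin a b)
  by (intros; now apply Rmin_pos).
assert (H0 : is_RInt_gen (Derive F) (at_right 0) (Rbar_locally p_infty) (0 - 0)).
{ apply is_RInt_gen_Derive.
  - revert Hpos; apply filter_imp; intros [a b] [Ha Hb] x Hx; simpl in *.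
    specialize (Hmin a b Ha Hb); eexists; apply HF; lra.
  - revert Hpos; apply filter_imp; intros [a b] [Ha Hb] x Hx; simpl in *.
    specialize (Hmin a b Ha Hb).
    assert (Hx0 : 0 < x) by lra.
    apply continuous_ext_loc with dF.
    + exists (mkposreal x Hx0); intros y Hy; symmetry; apply HD.
      change (Rabs (y - x) < x) in Hy; apply Rabs_def2 in Hy; lra.
    + apply (continuous_minus (V := R_NormedModule)).
      * apply (continuous_scal_r (V := R_NormedModule) s (gamma_integrand s)).
        now apply continuous_gamma_integrand.
      * now apply continuous_gamma_integrand.
  - apply (filterlim_le_le (fun _ => 0) _ (fun t => Rpower t s) 0).
    + exists (mkposreal 1 Rlt_0_1); intros t _ Ht; unfold F; split.
      * left; apply Rmult_lt_0_compat; apply exp_pos.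
      * rewrite <- (Rmult_1_r (Rpower t s)) at 2.
        apply Rmult_le_compat_l; [left; apply exp_pos|].
        rewrite <- exp_0; left; apply exp_increasing; lra.
    + apply filterlim_const.
    + now apply filterlim_Rpower_0.
  - now apply filterlim_Rpower_exp_opp_infty. }
destruct (is_RInt_gen_Gamma s Hs) as [H1 _].
destruct (is_RInt_gen_Gamma (s + 1)) as [H2 _]; [lra|].
assert (H3 := is_RInt_gen_minus _ _ _ _ (is_RInt_gen_scal _ s _ H1) H2).
assert (H4 : is_RInt_gen (Derive F) (at_right 0) (Rbar_locally p_infty)
          (minus (scal s (Gamma s)) (Gamma (s + 1)))).
{ apply is_RInt_gen_ext with (2 := H3).
  revert Hpos; apply filter_imp; intros [a b] [Ha Hb] x Hx; simpl in *.
  specialize (Hmin a b Ha Hb); rewrite HD by lra; reflexivity. }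
apply (is_RInt_gen_unique (V := R_CompleteNormedModule)) in H0.
apply (is_RInt_gen_unique (V := R_CompleteNormedModule)) in H4.
rewrite H0 in H4; unfold minus, plus, opp, scal in H4; simpl in H4.
unfold mult in H4; simpl in H4; lra.
Qed.

(** * The Bessel series *)

Definition bessel_coef (mu : R) (k : nat) : R :=
  (-1) ^ k / (INR (fact k) * Gamma (mu + INR k + 1)).

Lemma bessel_coef_order_succ (mu : R) (k : nat) :
  -1 < mu -> bessel_coef mu k = (mu + INR k + 1) * bessel_coef (mu + 1) k.
Proof.
intros Hmu; unfold bessel_coef.
assert (Hk := pos_INR k); assert (Hf := INR_fact_lt_0 k).
replace (mu + 1 + INR k + 1) with (mu + INR k + 1 + 1) by ring.
rewrite (Gamma_succ (mu + INR k + 1)) by lra.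
assert (0 < Gamma (mu + INR k + 1)) by (apply Gamma_pos; lra).
field; repeat split; lra.
Qed.

Lemma bessel_coef_succ (mu : R) (k : nat) :
  -1 < mu -> bessel_coef mu (S k) = - bessel_coef (mu + 1) k / (INR k + 1).
Proof.
intros Hmu; unfold bessel_coef.
assert (Hk := pos_INR k); assert (Hf := INR_fact_lt_0 k).
rewrite fact_simpl, mult_INR, S_INR; simpl pow.
replace (mu + (INR k + 1) + 1) with (mu + 1 + INR k + 1) by ring.
assert (0 < Gamma (mu + 1 + INR k + 1)) by (apply Gamma_pos; lra).
field; repeat split; lra.
Qed.

Lemma bessel_coef_neq_0 (mu : R) (k : nat) : -1 < mu -> bessel_coef mu k <> 0.
Proof.
intros Hmu; unfold bessel_coef, Rdiv.
assert (Hk := pos_INR k); assert (Hf := INR_fact_lt_0 k).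
assert (0 < Gamma (mu + INR k + 1)) by (apply Gamma_pos; lra).
apply Rmult_integral_contrapositive; split.
- apply pow_nonzero; lra.
- apply Rinv_neq_0_compat, Rmult_integral_contrapositive; lra.
Qed.

Lemma bessel_coef_ratio (mu : R) (k : nat) :
  -1 < mu ->
  bessel_coef mu (S k) = - / ((INR k + 1) * (mu + INR k + 1)) * bessel_coef mu k.
Proof.
intros Hmu; assert (Hk := pos_INR k).
rewrite bessel_coef_succ, (bessel_coef_order_succ mu k) by assumption.
field; lra.
Qed.

Lemma CV_radius_bessel_coef (mu : R) :
  -1 < mu -> CV_radius (bessel_coef mu) = p_infty.
Proof.
intros Hmu; apply CV_radius_infinite_DAlembert.
- intros n; now apply bessel_coef_neq_0.
- apply is_lim_seq_le_le_loc with (fun _ => 0) (fun n => / INR n).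
  + assert (H0 : eventually (fun n => (1 <= n)%nat)) by (exists 1%nat; auto).
    revert H0; apply filter_imp; intros n Hn; apply le_INR in Hn; simpl in Hn.
    split; [apply Rabs_pos|].
    rewrite bessel_coef_ratio by assumption.
    replace (_ / bessel_coef mu n) with (- / ((INR n + 1) * (mu + INR n + 1)))
      by (field; repeat split; try lra; now apply bessel_coef_neq_0).
    rewrite Rabs_Ropp, Rabs_inv, Rabs_right by nra.
    apply Rinv_le_contravar; nra.
  + apply is_lim_seq_const.
  + apply (is_lim_seq_inv INR p_infty); [apply is_lim_seq_INR|easy].
Qed.

Definition bessel_ps (mu t : R) : R := PSeries (bessel_coef mu) t.

Lemma Rabs_lt_CV_radius_bessel_coef (mu t : R) :
  -1 < mu -> Rbar_lt (Rabs t) (CV_radius (bessel_coef mu)).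
Proof. intros Hmu; now rewrite CV_radius_bessel_coef. Qed.

Lemma is_derive_bessel_ps (mu t : R) :
  -1 < mu -> is_derive (bessel_ps mu) t (- bessel_ps (mu + 1) t).
Proof.
intros Hmu.
apply is_derive_value with (PSeries (PS_derive (bessel_coef mu)) t).
- unfold bessel_ps; rewrite <- PSeries_opp; apply PSeries_ext; intros n.
  unfold PS_derive, PS_opp, opp; simpl opp.
  rewrite bessel_coef_succ by assumption.
  assert (Hn := pos_INR n); rewrite S_INR; simpl; field; lra.
- apply is_derive_PSeries; now apply Rabs_lt_CV_radius_bessel_coef.
Qed.

Lemma bessel_ps_contiguous (mu t : R) :
  0 < mu ->
  bessel_ps (mu - 1) t = mu * bessel_ps mu t - t * bessel_ps (mu + 1) t.
Proof.
intros Hmu; unfold bessel_ps at 1.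
rewrite (PSeries_ext _ (PS_plus (PS_scal mu (bessel_coef mu))
                      (PS_incr_1 (PS_derive (bessel_coef mu))))).
- assert (H : Rbar_lt (Rabs t) (CV_radius (bessel_coef mu)))
    by (apply Rabs_lt_CV_radius_bessel_coef; lra).
  rewrite PSeries_plus, PSeries_scal, PSeries_incr_1.
  + rewrite <- Derive_PSeries by assumption.
    change (PSeries (bessel_coef mu)) with (bessel_ps mu).
    rewrite (is_derive_unique _ _ _ (is_derive_bessel_ps mu t ltac:(lra))); ring.
  + apply (ex_pseries_scal (K := R_AbsRing)); [apply Rmult_comm|].
    now apply CV_radius_inside.
  + apply (ex_pseries_incr_1 (K := R_AbsRing) (V := R_NormedModule)).
    now apply ex_pseries_derive.
- intros n; rewrite bessel_coef_order_succ by lra.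
  replace (mu - 1 + 1) with mu by ring.
  unfold PS_plus, PS_scal, PS_incr_1, PS_derive, plus, scal; simpl; unfold mult; simpl.
  destruct n as [|n]; [simpl; unfold zero; simpl; ring|].
  change (match n with 0%nat => 1 | S _ => INR n + 1 end) with (INR (S n)).
  rewrite S_INR; ring.
Qed.

Lemma BesselJ_eq (mu x : R) :
  0 < x -> BesselJ mu x = Rpower (x / 2) mu * bessel_ps mu ((x / 2) ^ 2).
Proof.
intros Hx; unfold BesselJ, bessel_ps, PSeries.
rewrite <- Series_scal_l; apply Series_ext; intros k.
rewrite Rpower_plus.
replace (2 * INR k) with (INR (2 * k)) by now rewrite mult_INR.
rewrite Rpower_pow, pow_mult by lra; unfold bessel_coef.
ring.
Qed.

Lemma BesselJ_contiguous (mu x : R) :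
  0 < mu -> 0 < x ->
  BesselJ (mu - 1) x = 2 * mu / x * BesselJ mu x - BesselJ (mu + 1) x.
Proof.
intros Hmu Hx; rewrite !BesselJ_eq, bessel_ps_contiguous by assumption.
unfold Rminus at 1; rewrite !Rpower_plus, Rpower_Ropp, !Rpower_1 by lra.
field; lra.
Qed.

Lemma is_derive_BesselJ (mu x : R) :
  -1 < mu -> 0 < x ->
  is_derive (BesselJ mu) x (mu / x * BesselJ mu x - BesselJ (mu + 1) x).
Proof.
intros Hmu Hx.
apply is_derive_ext_loc with
  (fun x => Rpower (x / 2) mu * bessel_ps mu ((x / 2) ^ 2)).
- exists (mkposreal x Hx); intros y Hy; symmetry; apply BesselJ_eq.
  change (Rabs (y - x) < x) in Hy; apply Rabs_def2 in Hy; lra.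
- assert (H1 : is_derive (fun x => x / 2) x (/ 2)) by (auto_derive; [easy|field]).
  assert (H2 : is_derive (fun x => (x / 2) ^ 2) x (x / 2))
    by (auto_derive; [easy|field]).
  assert (H3 := is_derive_comp (fun u => Rpower u mu) _ x _ _
                  (is_derive_Rpower mu (x / 2) ltac:(lra)) H1).
  assert (H4 := is_derive_comp (bessel_ps mu) _ x _ _
                  (is_derive_bessel_ps mu ((x / 2) ^ 2) Hmu) H2).
  eapply is_derive_value; [|exact (is_derive_mult _ _ x _ _ H3 H4 Rmult_comm)].
  rewrite !BesselJ_eq by assumption.
  unfold plus, mult, scal; simpl; unfold mult; simpl.
  unfold Rminus at 1; rewrite !Rpower_plus, Rpower_Ropp, !Rpower_1 by lra.
  field; lra.
Qed.

Lemma bessel_ps_pos (mu t : R) : 0 < mu -> 0 <= t <= 1 -> 0 < bessel_ps mu t.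
Proof.
intros Hmu Ht.
set (U := fun k => (-1) ^ k * bessel_coef mu k * t ^ k).
assert (HU : forall k,
  0 <= U k /\ U (S k) = U k * (t / ((INR k + 1) * (mu + INR k + 1)))).
{ intros k; assert (Hk := pos_INR k); split.
  - unfold U, bessel_coef.
    assert (Hf := INR_fact_lt_0 k).
    assert (0 < Gamma (mu + INR k + 1)) by (apply Gamma_pos; lra).
    replace ((-1) ^ k * ((-1) ^ k / (INR (fact k) * Gamma (mu + INR k + 1))))
      with (/ (INR (fact k) * Gamma (mu + INR k + 1))).
    + apply Rmult_le_pos; [|apply pow_le; lra].
      left; apply Rinv_0_lt_compat; nra.
    + unfold Rdiv; rewrite <- Rmult_assoc, <- Rpow_mult_distr.
      replace (-1 * -1) with 1 by ring; rewrite pow1; ring.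
  - unfold U; rewrite bessel_coef_ratio by lra; simpl; field; lra. }
assert (Hlt : forall k, t / ((INR k + 1) * (mu + INR k + 1)) < 1).
{ intros k; assert (Hk := pos_INR k); apply Rlt_div_l; nra. }
assert (Hdec : Un_decreasing U).
{ intros k; destruct (HU k) as [H1 H2]; rewrite H2.
  rewrite <- (Rmult_1_r (U k)) at 2; apply Rmult_le_compat_l; [easy|].
  left; apply Hlt. }
assert (Htg : forall k, tg_alt U k = t ^ k * bessel_coef mu k).
{ intros k; unfold tg_alt, U; rewrite <- !Rmult_assoc, <- Rpow_mult_distr.
  replace (-1 * -1) with 1 by ring; rewrite pow1; ring. }
assert (Hex : ex_series (fun k => Rabs (bessel_coef mu k * t ^ k)))
  by (apply CV_disk_inside, Rabs_lt_CV_radius_bessel_coef; lra).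
assert (Hcv : Un_cv (fun N => sum_f_R0 (tg_alt U) N) (bessel_ps mu t)).
{ apply is_series_Reals.
  apply (is_series_ext (fun k => bessel_coef mu k * t ^ k)).
  - intros k; rewrite Htg; apply Rmult_comm.
  - apply (Series_correct (fun k => bessel_coef mu k * t ^ k)).
    now apply ex_series_Rabs. }
assert (H0 : Un_cv U 0).
{ apply is_lim_seq_Reals; apply ex_series_lim_0.
  apply (ex_series_ext (fun k => Rabs (bessel_coef mu k * t ^ k))); [|easy].
  intros k; destruct (HU k) as [H1 _].
  rewrite <- (Rabs_right (U k)) by lra; unfold U.
  rewrite Rmult_assoc, (Rabs_mult ((-1) ^ k)), pow_1_abs, Rmult_1_l; reflexivity. }
destruct (alternated_series_ineq U _ 0 Hdec H0 Hcv) as [H _].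
refine (Rlt_le_trans _ _ _ _ H); simpl; unfold tg_alt; simpl.
destruct (HU 0%nat) as [H1 ->]; simpl.
specialize (Hlt 0%nat); simpl in Hlt.
assert (0 < U 0%nat).
{ unfold U in *; simpl in *.
  assert (bessel_coef mu 0 <> 0) by (apply bessel_coef_neq_0; lra); lra. }
nra.
Qed.

Lemma BesselJ_pos (mu x : R) : 0 < mu -> 0 < x <= 2 -> 0 < BesselJ mu x.
Proof.
intros Hmu Hx; rewrite BesselJ_eq by lra.
apply Rmult_lt_0_compat; [apply exp_pos|apply bessel_ps_pos; nra].
Qed.

Lemma filterlim_BesselJ_0 (mu : R) :
  0 < mu -> filterlim (BesselJ mu) (at_right 0) (locally 0).
Proof.
intros Hmu.
apply filterlim_ext_loc with
  (fun x => Rpower (x / 2) mu * bessel_ps mu ((x / 2) ^ 2)).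
- exists (mkposreal 1 Rlt_0_1); intros y _ Hy; now rewrite BesselJ_eq.
- replace 0 with (0 * bessel_ps mu ((0 / 2) ^ 2)) at 2 by ring.
  eapply filterlim_comp_2; [| |apply (filterlim_mult (K := R_AbsRing))].
  + apply filterlim_comp with (2 := filterlim_Rpower_0 mu Hmu).
    intros P [eps HP]; exists eps; intros y Hy Hy'; apply HP; [|lra].
    change (Rabs (y - 0) < eps) in Hy; change (Rabs (y / 2 - 0) < eps).
    rewrite Rabs_right in * by lra; lra.
  + apply (filterlim_filter_le_1 (F := locally 0)).
    * intros P [eps HP]; exists eps; auto.
    * apply (ex_derive_continuous (V := R_NormedModule)
               (fun x => bessel_ps mu ((x / 2) ^ 2))).
      apply (ex_derive_comp (bessel_ps mu) (fun x => (x / 2) ^ 2)).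
      -- eexists; apply is_derive_bessel_ps; lra.
      -- auto_derive; easy.
Qed.

(** * The Bessel equation and its zeros *)

(* [x J_mu'(x)], see [is_derive_BesselJ_theta]. *)
Definition bessel_theta (mu x : R) : R :=
  mu * BesselJ mu x - x * BesselJ (mu + 1) x.

Lemma is_derive_BesselJ_theta (mu x : R) :
  0 < mu -> 0 < x -> is_derive (BesselJ mu) x (bessel_theta mu x / x).
Proof.
intros Hmu Hx; eapply is_derive_value; [|apply is_derive_BesselJ; lra].
unfold bessel_theta; field; lra.
Qed.

Lemma is_derive_bessel_theta (mu x : R) :
  0 < mu -> 0 < x ->
  is_derive (bessel_theta mu) x ((mu ^ 2 - x ^ 2) * BesselJ mu x / x).
Proof.
intros Hmu Hx; unfold bessel_theta.
assert (H1 := is_derive_BesselJ mu x ltac:(lra) Hx).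
assert (H2 := is_derive_BesselJ (mu + 1) x ltac:(lra) Hx).
assert (H3 := BesselJ_contiguous (mu + 1) x ltac:(lra) Hx).
replace (mu + 1 - 1) with mu in H3 by ring.
eapply is_derive_value; [|apply (is_derive_minus (V := R_NormedModule))].
3: apply (is_derive_mult (fun x => x) _ x _ _ (is_derive_id x) H2 Rmult_comm).
2: apply (is_derive_scal _ x mu _ H1).
unfold minus, plus, opp, scal, mult; simpl; unfold mult, one; simpl.
assert (H4 : BesselJ (mu + 1 + 1) x
  = 2 * (mu + 1) / x * BesselJ (mu + 1) x - BesselJ mu x) by lra.
rewrite H4; field; lra.
Qed.

Lemma Derive_BesselJ (mu x : R) :
  0 < mu -> 0 < x -> Derive (fun x => BesselJ mu x) x = bessel_theta mu x / x.
Proof. intros; now apply is_derive_unique, is_derive_BesselJ_theta. Qed.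

Lemma Derive_bessel_theta (mu x : R) :
  0 < mu -> 0 < x ->
  Derive (fun x => bessel_theta mu x) x = (mu ^ 2 - x ^ 2) * BesselJ mu x / x.
Proof. intros; now apply is_derive_unique, is_derive_bessel_theta. Qed.

Lemma filterlim_bessel_theta_0 (mu : R) :
  0 < mu -> filterlim (bessel_theta mu) (at_right 0) (locally 0).
Proof.
intros Hmu; unfold bessel_theta.
apply filterlim_ext with (fun x => mu * BesselJ mu x + - x * BesselJ (mu + 1) x);
  [intros; ring|].
replace 0 with (mu * 0 + - 0 * 0) at 2 by ring.
assert (Hid : filterlim (fun x : R => - x) (at_right 0) (locally (- 0))).
{ apply (filterlim_filter_le_1 (F := locally 0)).
  - intros P [eps HP]; exists eps; auto.
  - apply (filterlim_opp (V := R_NormedModule)). }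
eapply filterlim_comp_2.
- eapply filterlim_comp_2; [apply filterlim_const|now apply filterlim_BesselJ_0|].
  apply (filterlim_mult (K := R_AbsRing)).
- eapply filterlim_comp_2; [exact Hid|apply filterlim_BesselJ_0; lra|].
  apply (filterlim_mult (K := R_AbsRing)).
- apply (filterlim_plus (V := R_NormedModule)).
Qed.

Definition bessel_energy (mu x : R) : R :=
  bessel_theta mu x ^ 2 + (x ^ 2 - mu ^ 2) * BesselJ mu x ^ 2.

Lemma is_derive_bessel_energy (mu x : R) :
  0 < mu -> 0 < x -> is_derive (bessel_energy mu) x (2 * x * BesselJ mu x ^ 2).
Proof.
intros Hmu Hx; unfold bessel_energy.
assert (H1 := is_derive_BesselJ_theta mu x Hmu Hx).
assert (H2 := is_derive_bessel_theta mu x Hmu Hx).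
auto_derive.
- repeat split; eexists; eassumption.
- rewrite Derive_BesselJ, Derive_bessel_theta by lra; field; lra.
Qed.

Lemma filterlim_bessel_energy_0 (mu : R) :
  0 < mu -> filterlim (bessel_energy mu) (at_right 0) (locally 0).
Proof.
intros Hmu; unfold bessel_energy.
assert (Hid : filterlim (fun x : R => x ^ 2 - mu ^ 2)
  (at_right 0) (locally (0 ^ 2 - mu ^ 2))).
{ apply (filterlim_filter_le_1 (F := locally 0)).
  - intros P [eps HP]; exists eps; auto.
  - apply (ex_derive_continuous (V := R_NormedModule) (fun x : R => x ^ 2 - mu ^ 2)).
    auto_derive; easy. }
assert (Hsq : forall f : R -> R, filterlim f (at_right 0) (locally 0) ->
  filterlim (fun x => f x ^ 2) (at_right 0) (locally 0)).
{ intros f Hf; replace 0 with (0 ^ 2) at 2 by ring.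
  apply (filterlim_comp _ _ _ f (fun x => x ^ 2) _ _ _ Hf).
  apply (ex_derive_continuous (V := R_NormedModule) (fun x : R => x ^ 2)).
  auto_derive; easy. }
replace 0 with (0 + (0 ^ 2 - mu ^ 2) * 0) at 2 by ring.
eapply filterlim_comp_2.
- apply Hsq; now apply filterlim_bessel_theta_0.
- eapply filterlim_comp_2; [exact Hid|apply Hsq; now apply filterlim_BesselJ_0|].
  apply (filterlim_mult (K := R_AbsRing)).
- apply (filterlim_plus (V := R_NormedModule)).
Qed.

Lemma bessel_energy_pos (mu x : R) : 0 < mu -> 0 < x -> 0 < bessel_energy mu x.
Proof.
intros Hmu Hx.
assert (Hsmall : forall b, 0 < b <= 2 -> 0 < bessel_energy mu b).
{ intros b Hb; apply (derive_pos_lim_0_pos _ (fun x => 2 * x * BesselJ mu x ^ 2) 0);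
    [lra|now apply filterlim_bessel_energy_0| |].
  - intros y Hy; apply is_derive_bessel_energy; lra.
  - intros y Hy; assert (H := BesselJ_pos mu y Hmu ltac:(lra)).
    apply Rmult_lt_0_compat; [lra|nra]. }
destruct (Rle_or_lt x 2) as [H|H]; [apply Hsmall; lra|].
apply Rlt_le_trans with (1 := Hsmall 2 ltac:(lra)).
apply (derive_nonneg_le _ (fun x => 2 * x * BesselJ mu x ^ 2)); [lra| |].
- intros; apply is_derive_bessel_energy; lra.
- intros y Hy; apply Rmult_le_pos; [lra|apply pow2_ge_0].
Qed.

Lemma bessel_theta_neq_0 (mu x : R) :
  0 < mu -> 0 < x -> BesselJ mu x = 0 -> bessel_theta mu x <> 0.
Proof.
intros Hmu Hx HJ Ht; assert (H := bessel_energy_pos mu x Hmu Hx).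
unfold bessel_energy in H; rewrite HJ, Ht in H; lra.
Qed.

Lemma BesselJ_isolated_zero (mu a : R) :
  0 < mu -> 0 < a -> BesselJ mu a = 0 ->
  exists d, 0 < d /\ forall x, x <> a -> Rabs (x - a) < d -> BesselJ mu x <> 0.
Proof.
intros Hmu Ha HJ.
apply is_derive_isolated_zero with (1 := is_derive_BesselJ_theta mu a Hmu Ha); [easy|].
apply Rmult_integral_contrapositive; split.
- now apply bessel_theta_neq_0.
- apply Rinv_neq_0_compat; lra.
Qed.

Lemma continuity_pt_BesselJ (mu x : R) :
  0 < mu -> 0 < x -> continuity_pt (BesselJ mu) x.
Proof.
intros Hmu Hx; eapply is_derive_continuity_pt; now apply is_derive_BesselJ_theta.
Qed.

Lemma continuity_pt_bessel_theta (mu x : R) :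
  0 < mu -> 0 < x -> continuity_pt (bessel_theta mu) x.
Proof.
intros Hmu Hx; eapply is_derive_continuity_pt; now apply is_derive_bessel_theta.
Qed.

(* Sturm comparison with [sin (ln (x / A))], a solution of [x (x y')' = - y]. *)
Lemma BesselJ_zero_unbounded (mu a : R) :
  0 < mu -> exists x, a < x /\ BesselJ mu x = 0.
Proof.
intros Hmu; apply Classical_Prop.NNPP; intros Hn.
set (A := Rmax a 0 + mu + 1).
assert (HA : a < A /\ mu + 1 <= A).
{ unfold A; generalize (Rmax_l a 0) (Rmax_r a 0); lra. }
assert (Hnz : forall x, A <= x -> BesselJ mu x <> 0).
{ intros x Hx HJ; apply Hn; exists x; split; [lra|easy]. }
assert (Hpi := PI_RGT_0).
set (B := A * exp PI).
assert (He : 1 < exp PI) by (rewrite <- exp_0; now apply exp_increasing).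
assert (HAB : A < B) by (unfold B; nra).
set (F := fun x => BesselJ mu A * (BesselJ mu x * cos (ln (x / A))
                     - bessel_theta mu x * sin (ln (x / A)))).
set (dF := fun x => BesselJ mu A * BesselJ mu x * (sin (ln (x / A)) *
                       (x ^ 2 - mu ^ 2 - 1)) / x).
assert (H : F A < F B).
{ apply (derive_pos_lt F dF); [easy| |].
  - intros x Hx.
    assert (H1 := is_derive_BesselJ_theta mu x Hmu ltac:(lra)).
    assert (H2 := is_derive_bessel_theta mu x Hmu ltac:(lra)).
    unfold F, dF; auto_derive.
    + assert (0 < x * / A) by (apply Rdiv_lt_0_compat; lra).
      repeat split; try easy; eexists; eassumption.
    + rewrite Derive_BesselJ, Derive_bessel_theta by lra.
      change (x * / A) with (x / A); field; lra.
  - intros x Hx; unfold dF.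
    assert (HJ : 0 < BesselJ mu A * BesselJ mu x).
    { apply no_zero_same_sign; [lra| |].
      - intros; apply continuity_pt_BesselJ; lra.
      - intros; apply Hnz; lra. }
    assert (Hs : 0 < sin (ln (x / A))).
    { apply sin_gt_0.
      - rewrite <- ln_1; apply ln_increasing; [lra|]; apply Rlt_div_r; lra.
      - rewrite <- (ln_exp PI); apply ln_increasing.
        + apply Rdiv_lt_0_compat; lra.
        + apply Rlt_div_l; [lra|]; unfold B in Hx; lra. }
    apply Rdiv_lt_0_compat; [|lra].
    apply Rmult_lt_0_compat; [easy|]; apply Rmult_lt_0_compat; [easy|nra]. }
unfold F in H.
replace (A / A) with 1 in H by (field; lra).
replace (B / A) with (exp PI) in H by (unfold B; field; lra).
rewrite ln_1, ln_exp, sin_0, cos_0, sin_PI, cos_PI in H.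
assert (0 < BesselJ mu A * BesselJ mu B).
{ apply no_zero_same_sign; [lra| |].
  - intros; apply continuity_pt_BesselJ; lra.
  - intros; apply Hnz; lra. }
nra.
Qed.

Lemma bessel_zero_spec (mu : R) (n : nat) :
  0 < mu ->
  0 <= bessel_zero mu n < bessel_zero mu (S n) /\
  BesselJ mu (bessel_zero mu (S n)) = 0 /\
  forall x, zero_interval mu n x -> BesselJ mu x <> 0.
Proof.
intros Hmu; unfold zero_interval, bessel_zero; revert n; apply pos_zero_spec.
- intros; now apply continuity_pt_BesselJ.
- intros; now apply BesselJ_zero_unbounded.
- intros a [->|[Ha HJ]].
  + exists 2; split; [lra|]; intros x Hx.
    apply Rgt_not_eq, BesselJ_pos; lra.
  + destruct (BesselJ_isolated_zero mu a Hmu Ha HJ) as (d & Hd & H).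
    exists d; split; [easy|]; intros x Hx; apply H; [lra|].
    rewrite Rabs_right; lra.
Qed.

Lemma bessel_zero_1_gt (mu : R) : 0 < mu -> 2 < bessel_zero mu 1.
Proof.
intros Hmu; destruct (bessel_zero_spec mu 0 Hmu) as (H1 & H2 & _).
apply Rnot_le_lt; intros H.
assert (H3 := BesselJ_pos mu (bessel_zero mu 1) Hmu ltac:(lra)); lra.
Qed.

Lemma bessel_zero_le (mu : R) (m n : nat) :
  0 < mu -> (m <= n)%nat -> bessel_zero mu m <= bessel_zero mu n.
Proof.
intros Hmu Hmn; induction Hmn as [|n _ IH]; [lra|].
destruct (bessel_zero_spec mu n Hmu) as (H & _); lra.
Qed.

Lemma is_lim_seq_bessel_zero (mu : R) :
  0 < mu -> is_lim_seq (bessel_zero mu) p_infty.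
Proof.
intros Hmu.
assert (Hinc : forall n, bessel_zero mu n <= bessel_zero mu (S n))
  by (intros n; apply bessel_zero_le; [easy|lia]).
destruct (ex_lim_seq_incr _ Hinc) as [[l| |] Hl]; [exfalso|easy|exfalso].
- assert (Hub : forall n, bessel_zero mu n < l).
  { intros n; destruct (bessel_zero_spec mu n Hmu) as ((_ & H) & _).
    apply Rlt_le_trans with (1 := H).
    now apply (is_lim_seq_incr_compare (bessel_zero mu) l). }
  assert (Hpos : 0 < l)
    by (specialize (Hub 1%nat); assert (H := bessel_zero_1_gt mu Hmu); lra).
  assert (HJ : BesselJ mu l = 0).
  { assert (H : is_lim_seq (fun n => BesselJ mu (bessel_zero mu (S n))) (BesselJ mu l)).
    { apply is_lim_seq_continuous; [now apply continuity_pt_BesselJ|].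
      now apply is_lim_seq_incr_1 in Hl. }
    apply (is_lim_seq_ext _ (fun _ => 0)) in H.
    - apply is_lim_seq_unique in H; rewrite Lim_seq_const in H; now injection H.
    - intros n; now destruct (bessel_zero_spec mu n Hmu) as (_ & H' & _). }
  destruct (BesselJ_isolated_zero mu l Hmu Hpos HJ) as (d & Hd & H).
  apply is_lim_seq_spec in Hl.
  destruct (Hl (mkposreal d Hd)) as [N HN]; simpl in HN.
  apply (H (bessel_zero mu (S N))).
  + specialize (Hub (S N)); lra.
  + apply HN; lia.
  + now destruct (bessel_zero_spec mu N Hmu) as (_ & H' & _).
- apply is_lim_seq_spec in Hl; destruct (Hl 0) as [N HN].
  specialize (HN N ltac:(lia)).
  destruct (bessel_zero_spec mu N Hmu) as (H & _); lra.
Qed.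

(** * The minimum *)

Lemma Phi_eq (mu x : R) :
  0 < mu -> 0 < x -> BesselJ mu x <> 0 ->
  Phi mu x = 1 + ((bessel_theta mu x / BesselJ mu x) ^ 2 - mu ^ 2) / x ^ 2.
Proof.
intros Hmu Hx HJ; unfold Phi, bessel_theta.
rewrite BesselJ_contiguous by easy; field; lra.
Qed.

Lemma bessel_energy_eq (mu x : R) :
  BesselJ mu x <> 0 ->
  bessel_energy mu x =
  BesselJ mu x ^ 2 * ((bessel_theta mu x / BesselJ mu x) ^ 2 + x ^ 2 - mu ^ 2).
Proof. intros HJ; unfold bessel_energy; field; easy. Qed.

Lemma critical_range (mu q x : R) :
  0 < mu -> 2 < x -> 0 < q ^ 2 + x ^ 2 - mu ^ 2 ->
  (1 + q) * (q ^ 2 + x ^ 2 - mu ^ 2) = x ^ 2 ->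
  0 < q < mu.
Proof.
intros Hmu Hx He Hc.
assert (Hq : 0 < 1 + q) by nra.
assert (Hc' : q * x ^ 2 = (mu ^ 2 - q ^ 2) * (1 + q)) by nra.
assert (Hx2 : 4 < x ^ 2) by nra.
split.
- apply Rnot_le_lt; intros H.
  assert (q ^ 2 * (1 + q) <= - q) by nra.
  assert (0 < mu ^ 2 * (1 + q)) by (apply Rmult_lt_0_compat; nra).
  nra.
- apply Rnot_le_lt; intros H.
  assert (mu ^ 2 - q ^ 2 <= 0) by nra.
  nra.
Qed.

(* The minima of [Phi] are the maxima of [1 / Phi = x ^ 2 * J ^ 2 / energy],
   which extends by [0] to the endpoints of the interval. *)
Lemma beta_spec (mu : R) (n : nat) :
  0 < mu -> (1 <= n)%nat ->
  exists x q,
    zero_interval mu n x /\ Phi mu x = beta mu n /\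
    (forall y, zero_interval mu n y -> beta mu n <= Phi mu y) /\
    0 < q < mu /\ q = bessel_theta mu x / BesselJ mu x /\
    q * x ^ 2 = (mu ^ 2 - q ^ 2) * (1 + q) /\ beta mu n = / (1 + q).
Proof.
intros Hmu Hn.
set (a := bessel_zero mu n); set (b := bessel_zero mu (S n)).
destruct (bessel_zero_spec mu n Hmu) as ((_ & Hab) & Hb & Hnz).
fold a b in Hab, Hb.
assert (Ha2 : 2 < a).
{ apply Rlt_le_trans with (1 := bessel_zero_1_gt mu Hmu).
  now apply bessel_zero_le. }
assert (Ha : BesselJ mu a = 0).
{ destruct n as [|n]; [lia|]; now destruct (bessel_zero_spec mu n Hmu) as (_ & H & _). }
set (g := fun x => x ^ 2 * BesselJ mu x ^ 2 / bessel_energy mu x).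
assert (Hpos : forall x, a <= x -> 0 < bessel_energy mu x)
  by (intros; apply bessel_energy_pos; lra).
assert (Hg : forall x, a <= x -> is_derive g x
  ((2 * x * BesselJ mu x ^ 2 + 2 * x * BesselJ mu x * bessel_theta mu x)
     / bessel_energy mu x
   - x ^ 2 * BesselJ mu x ^ 2 * (2 * x * BesselJ mu x ^ 2) / bessel_energy mu x ^ 2)).
{ intros x Hx; specialize (Hpos x Hx).
  assert (H1 := is_derive_BesselJ_theta mu x Hmu ltac:(lra)).
  assert (H2 := is_derive_bessel_energy mu x Hmu ltac:(lra)).
  assert (H3 : Derive (fun x => bessel_energy mu x) x = 2 * x * BesselJ mu x ^ 2)
    by (now apply is_derive_unique).
  unfold g; auto_derive.
  - repeat split; try lra; eexists; eassumption.
  - rewrite Derive_BesselJ, H3 by lra; field; lra. }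
destruct (continuity_ab_maj g a b) as (x & Hmax & Hx); [lra| |].
{ intros c Hc; apply (is_derive_continuity_pt _ _ _ (Hg c ltac:(lra))). }
assert (Hgpos : forall y, zero_interval mu n y -> 0 < g y).
{ intros y Hy; specialize (Hnz y Hy).
  unfold zero_interval in Hy; fold a b in Hy; unfold g.
  apply Rdiv_lt_0_compat; [|apply Hpos; lra].
  apply Rmult_lt_0_compat; [nra|].
  now apply pow2_pos. }
assert (Hgx : 0 < g x).
{ apply Rlt_le_trans with (g ((a + b) / 2)).
  - apply Hgpos; unfold zero_interval; fold a b; lra.
  - apply Hmax; lra. }
assert (Hxi : zero_interval mu n x).
{ unfold zero_interval; fold a b.
  assert (Hend : forall y, BesselJ mu y = 0 -> x <> y).
  { intros y Hy ->; unfold g in Hgx; rewrite Hy in Hgx.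
    unfold Rdiv in Hgx; lra. }
  assert (H1 := Hend a Ha); assert (H2 := Hend b Hb); lra. }
assert (HJ := Hnz x Hxi).
set (q := bessel_theta mu x / BesselJ mu x).
assert (Hgphi : forall y, zero_interval mu n y -> Phi mu y = / g y).
{ intros y Hy; assert (HJy := Hnz y Hy).
  unfold zero_interval in Hy; fold a b in Hy.
  rewrite Phi_eq by (easy || lra).
  assert (He := Hpos y ltac:(lra)); unfold g.
  replace (1 + _) with (bessel_energy mu y / (y ^ 2 * BesselJ mu y ^ 2))
    by (unfold bessel_energy; field; split; lra || easy).
  field; repeat split; lra || easy. }
assert (Hmin : forall y, zero_interval mu n y -> Phi mu x <= Phi mu y).
{ intros y Hy; rewrite !Hgphi by easy.
  apply Rinv_le_contravar; [now apply Hgpos|].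
  apply Hmax; unfold zero_interval in Hy; fold a b in Hy; lra. }
assert (Hbeta : beta mu n = Phi mu x).
{ unfold beta; rewrite (is_glb_Rbar_unique _ (Finite (Phi mu x))); [easy|].
  split.
  - intros v (y & Hy & ->); now apply Hmin.
  - intros l Hl; apply Hl; now exists x. }
unfold zero_interval in Hxi; fold a b in Hxi.
assert (He := Hpos x ltac:(lra)); rewrite bessel_energy_eq in He by easy; fold q in He.
assert (HJ2 := pow2_pos _ HJ).
set (e := q ^ 2 + x ^ 2 - mu ^ 2) in *.
assert (He' : 0 < e) by nra.
assert (Hcrit : (1 + q) * e = x ^ 2).
{ assert (Hd := Hg x ltac:(lra)); apply is_derive_Reals in Hd.
  assert (H0 := deriv_maximum g a b x (exist _ _ Hd) (proj1 Hxi) (proj2 Hxi)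
                 (fun y H1 H2 => Hmax y (conj (Rlt_le _ _ H1) (Rlt_le _ _ H2)))).
  simpl in H0.
  rewrite bessel_energy_eq in H0 by easy; fold q in H0; fold e in H0.
  replace (bessel_theta mu x) with (q * BesselJ mu x) in H0 by (unfold q; field; easy).
  assert (H1 : 2 * x / e ^ 2 * ((1 + q) * e - x ^ 2) = 0).
  { rewrite <- H0; simpl; field; lra. }
  apply Rmult_integral in H1; destruct H1 as [H1|H1]; [|lra].
  assert (0 < 2 * x / e ^ 2) by (apply Rdiv_lt_0_compat; nra); lra. }
assert (Hq : 0 < q < mu) by (apply (critical_range mu q x); [easy|lra|easy|easy]).
exists x, q; repeat split; try tauto; try easy.
- intros y Hy; rewrite Hbeta; now apply Hmin.
- unfold e in Hcrit; nra.
- rewrite Hbeta, Phi_eq by (easy || lra); fold q.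
  assert (Hx2 : x ^ 2 <> 0) by (apply pow_nonzero; lra).
  apply Rmult_eq_reg_r with (x ^ 2 * (1 + q)); [|nra].
  replace ((1 + (q ^ 2 - mu ^ 2) / x ^ 2) * (x ^ 2 * (1 + q))) with ((1 + q) * e)
    by (unfold e; field; lra).
  rewrite Hcrit; field; lra.
Qed.

Lemma critical_anti (m q q' x x' : R) :
  0 < q -> q <= q' -> q' ^ 2 < m ->
  q * x = (m - q ^ 2) * (1 + q) -> q' * x' = (m - q' ^ 2) * (1 + q') -> x' <= x.
Proof.
intros Hq Hqq Hm E E'.
replace x with ((m - q ^ 2) * (1 + / q)) by (apply Rmult_eq_reg_l with q; [|lra];
  rewrite E; field; lra).
replace x' with ((m - q' ^ 2) * (1 + / q')) by (apply Rmult_eq_reg_l with q'; [|lra];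
  rewrite E'; field; lra).
assert (/ q' <= / q) by (apply Rinv_le_contravar; lra).
assert (0 < / q') by (apply Rinv_0_lt_compat; lra).
apply Rmult_le_compat; nra.
Qed.

Lemma beta_incr (mu : R) (n : nat) :
  0 < mu -> (1 <= n)%nat -> beta mu n < beta mu (S n).
Proof.
intros Hmu Hn.
destruct (beta_spec mu n Hmu Hn) as (x & q & Hx & _ & _ & Hq & _ & E & ->).
destruct (beta_spec mu (S n) Hmu ltac:(lia))
  as (x' & q' & Hx' & _ & _ & Hq' & _ & E' & ->).
apply Rinv_lt_contravar; [nra|]; apply Rplus_lt_compat_l, Rnot_le_lt; intros Hqq.
assert (H := critical_anti (mu ^ 2) q q' (x ^ 2) (x' ^ 2)
  ltac:(lra) Hqq ltac:(nra) E E').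
unfold zero_interval in *.
destruct (bessel_zero_spec mu n Hmu) as (H0 & _); nra.
Qed.

Lemma beta_lt_1 (mu : R) (n : nat) : 0 < mu -> (1 <= n)%nat -> beta mu n < 1.
Proof.
intros Hmu Hn.
destruct (beta_spec mu n Hmu Hn) as (x & q & _ & _ & _ & Hq & _ & _ & ->).
rewrite <- Rinv_1; apply Rinv_lt_contravar; lra.
Qed.

Lemma beta_gt (mu : R) (n : nat) :
  0 < mu -> (1 <= n)%nat -> 1 / (mu + 1) < beta mu n.
Proof.
intros Hmu Hn.
destruct (beta_spec mu n Hmu Hn) as (x & q & _ & _ & _ & Hq & _ & _ & ->).
unfold Rdiv; rewrite Rmult_1_l; apply Rinv_lt_contravar; nra.
Qed.

Lemma is_lim_seq_beta (mu : R) : 0 < mu -> is_lim_seq (beta mu) 1.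
Proof.
intros Hmu.
apply is_lim_seq_le_le_loc with
  (fun n => 1 - mu ^ 2 * / (bessel_zero mu n)) (fun _ => 1).
- exists 1%nat; intros n Hn; split; [|now left; apply beta_lt_1].
  destruct (beta_spec mu n Hmu Hn) as (x & q & Hx & <- & _ & _ & Hq & _).
  destruct (bessel_zero_spec mu n Hmu) as (_ & _ & HJ).
  specialize (HJ x Hx); destruct Hx as [Hx _].
  assert (Hz : 2 < bessel_zero mu n).
  { apply Rlt_le_trans with (1 := bessel_zero_1_gt mu Hmu).
    now apply bessel_zero_le. }
  rewrite Phi_eq by (easy || lra); rewrite <- Hq.
  assert (H1 : / x ^ 2 <= / bessel_zero mu n) by (apply Rinv_le_contravar; nra).
  assert (H2 : 0 < / x ^ 2) by (apply Rinv_0_lt_compat; nra).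
  unfold Rdiv.
  assert (0 <= q ^ 2 * / x ^ 2) by (apply Rmult_le_pos; nra).
  assert (mu ^ 2 * / x ^ 2 <= mu ^ 2 * / bessel_zero mu n)
    by (apply Rmult_le_compat_l; nra).
  lra.
- replace (Finite 1) with (Rbar_minus 1 (Rbar_mult (mu ^ 2) (Rbar_inv p_infty)))
    by (simpl; f_equal; ring).
  apply is_lim_seq_minus'; [apply is_lim_seq_const|].
  apply (is_lim_seq_scal_l _ (mu ^ 2) (Rbar_inv p_infty)).
  apply is_lim_seq_inv; [now apply is_lim_seq_bessel_zero|easy].
- apply is_lim_seq_const.
Qed.

(** * Comparison of two orders *)

Lemma derive_pos_lim_0_ends (f df : R -> R) (a b : R) :
  a < b ->
  filterlim f (at_right a) (locally 0) ->
  filterlim f (at_left b) (locally 0) ->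
  (forall x, a < x < b -> is_derive f x (df x)) ->
  (forall x, a < x < b -> 0 < df x) ->
  False.
Proof.
intros Hab Ha Hb Hd Hp.
set (c := (a + b) / 2).
assert (H1 : 0 < f c).
{ apply (derive_pos_lim_0_pos f df a c); try easy; unfold c in *.
  - lra.
  - intros; apply Hd; lra.
  - intros; apply Hp; lra. }
assert (H2 : 0 < - f (- - c)).
{ apply (derive_pos_lim_0_pos (fun x => - f (- x)) (fun x => df (- x)) (- b) (- c));
    unfold c in *.
  - lra.
  - replace 0 with (- 0) by ring.
    apply (filterlim_comp _ _ _ (fun x => f (- x)) Ropp _ (locally 0)).
    + apply (filterlim_comp _ _ _ Ropp f _ (at_left b)); [|exact Hb].
      rewrite <- (Ropp_involutive b) at 2; apply filterlim_Ropp_right.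
    + apply (filterlim_opp (V := R_NormedModule)).
  - intros x Hx.
    assert (H2 := is_derive_comp f Ropp x _ _ (Hd (- x) ltac:(lra))
                    (is_derive_opp _ x _ (is_derive_id x))).
    apply (is_derive_opp (V := R_NormedModule)) in H2.
    eapply is_derive_value; [|exact H2].
    unfold opp, scal, one; simpl; unfold mult; simpl; ring.
  - intros; apply Hp; lra. }
rewrite Ropp_involutive in H2; lra.
Qed.

Definition scaled_J (mu s : R) : R := BesselJ mu (mu * s).

Definition scaled_theta (mu s : R) : R := bessel_theta mu (mu * s) / mu.

Lemma is_derive_scaled_J (mu s : R) :
  0 < mu -> 0 < s ->
  is_derive (fun s => scaled_J mu s) s (mu * scaled_theta mu s / s).
Proof.
intros Hmu Hs; unfold scaled_J, scaled_theta.
assert (Hms : 0 < mu * s) by nra.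
assert (H1 := is_derive_BesselJ_theta mu (mu * s) Hmu Hms).
assert (H2 : is_derive (fun s => mu * s) s mu) by (auto_derive; [easy|ring]).
eapply is_derive_value; [|exact (is_derive_comp _ _ s _ _ H1 H2)].
unfold scal; simpl; unfold mult; simpl; field; lra.
Qed.

Lemma is_derive_scaled_theta (mu s : R) :
  0 < mu -> 0 < s ->
  is_derive (fun s => scaled_theta mu s) s (mu * (1 - s ^ 2) * scaled_J mu s / s).
Proof.
intros Hmu Hs; unfold scaled_J, scaled_theta.
assert (Hms : 0 < mu * s) by nra.
assert (H1 := is_derive_bessel_theta mu (mu * s) Hmu Hms).
assert (H2 : is_derive (fun s => mu * s) s mu) by (auto_derive; [easy|ring]).
assert (H3 := is_derive_scal _ s (/ mu) _ (is_derive_comp _ _ s _ _ H1 H2)).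
apply is_derive_ext with (fun s => / mu * bessel_theta mu (mu * s));
  [intros; apply Rmult_comm|].
eapply is_derive_value; [|exact H3].
unfold scal; simpl; unfold mult; simpl; field; lra.
Qed.

Lemma Derive_scaled_J (mu s : R) :
  0 < mu -> 0 < s -> Derive (fun s => scaled_J mu s) s = mu * scaled_theta mu s / s.
Proof. intros; now apply is_derive_unique, is_derive_scaled_J. Qed.

Lemma Derive_scaled_theta (mu s : R) :
  0 < mu -> 0 < s ->
  Derive (fun s => scaled_theta mu s) s = mu * (1 - s ^ 2) * scaled_J mu s / s.
Proof. intros; now apply is_derive_unique, is_derive_scaled_theta. Qed.

Lemma filterlim_scal_at_right_0 (mu : R) :
  0 < mu -> filterlim (fun s => mu * s) (at_right 0) (at_right 0).
Proof.
intros Hmu P [eps HP].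
assert (He : 0 < eps / mu) by (apply Rdiv_lt_0_compat; [apply cond_pos|easy]).
exists (mkposreal _ He); intros s Hs Hs'.
change (Rabs (s - 0) < eps / mu) in Hs; rewrite Rabs_right in Hs by lra.
apply HP; [|nra]; change (Rabs (mu * s - 0) < eps).
rewrite Rabs_right by nra.
apply Rlt_div_r in Hs; lra.
Qed.

Lemma filterlim_scaled_at_right (mu a : R) :
  0 < mu -> 0 <= a ->
  exists l m,
    filterlim (fun s => scaled_J mu s) (at_right a) (locally l) /\
    filterlim (fun s => scaled_theta mu s) (at_right a) (locally m) /\
    ((a = 0 \/ scaled_J mu a = 0) -> l = 0).
Proof.
intros Hmu [Ha|<-].
- exists (scaled_J mu a), (scaled_theta mu a); repeat split.
  + apply (filterlim_filter_le_1 (F := locally a)).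
    * intros P [eps HP]; exists eps; auto.
    * apply (ex_derive_continuous (V := R_NormedModule) (fun s => scaled_J mu s)).
      eexists; now apply is_derive_scaled_J.
  + apply (filterlim_filter_le_1 (F := locally a)).
    * intros P [eps HP]; exists eps; auto.
    * apply (ex_derive_continuous (V := R_NormedModule) (fun s => scaled_theta mu s)).
      eexists; now apply is_derive_scaled_theta.
  + intros [H|H]; [lra|easy].
- exists 0, (0 * / mu); repeat split.
  + apply filterlim_comp with (1 := filterlim_scal_at_right_0 mu Hmu).
    now apply filterlim_BesselJ_0.
  + refine (filterlim_comp_2 (fun s => bessel_theta mu (mu * s)) (fun _ => / mu) Rmult
              _ (filterlim_const _) (filterlim_mult (K := R_AbsRing) 0 (/ mu))).
    apply filterlim_comp with (1 := filterlim_scal_at_right_0 mu Hmu).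
    now apply filterlim_bessel_theta_0.
Qed.

(* For [mu < nu] the exponent makes the derivative have the sign of
   [scaled_J mu s * scaled_J nu s]; see [is_derive_sturm]. *)
Definition sturm (mu nu s : R) : R :=
  (scaled_J nu s * scaled_theta mu s - scaled_J mu s * scaled_theta nu s)
  * Rpower (scaled_J mu s ^ 2) ((nu / mu - 1) / 2).

Definition sturm_rate (mu nu s : R) : R :=
  (nu - mu) * Rpower (scaled_J mu s ^ 2) ((nu / mu - 1) / 2)
  * bessel_energy mu (mu * s) / (mu ^ 2 * s * scaled_J mu s ^ 2).

Lemma is_derive_sturm (mu nu s : R) :
  0 < mu -> 0 < nu -> 0 < s -> scaled_J mu s <> 0 ->
  is_derive (sturm mu nu) s
    (scaled_J mu s * scaled_J nu s * sturm_rate mu nu s).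
Proof.
intros Hmu Hnu Hs HJ; unfold sturm.
assert (H1 := is_derive_scaled_J mu s Hmu Hs).
assert (H2 := is_derive_scaled_theta mu s Hmu Hs).
assert (H3 := is_derive_scaled_J nu s Hnu Hs).
assert (H4 := is_derive_scaled_theta nu s Hnu Hs).
assert (HJ2 := pow2_pos _ HJ).
set (k := (nu / mu - 1) / 2).
assert (H5 : is_derive (fun s => scaled_J mu s ^ 2) s
   (2 * scaled_J mu s * (mu * scaled_theta mu s / s))).
{ auto_derive; [eexists; exact H1|].
  rewrite Derive_scaled_J by easy; ring. }
assert (H6 := is_derive_comp (fun u => Rpower u k) _ s _ _
                (is_derive_Rpower k _ HJ2) H5).
assert (H7 : is_derive (fun s => scaled_J nu s * scaled_theta mu s
     - scaled_J mu s * scaled_theta nu s) s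
   ((nu - mu) / s * (scaled_theta mu s * scaled_theta nu s
      - (1 - s ^ 2) * scaled_J mu s * scaled_J nu s))).
{ auto_derive; [repeat split; eexists; eassumption|].
  rewrite !Derive_scaled_J, !Derive_scaled_theta by easy; field; lra. }
eapply is_derive_value; [|exact (is_derive_mult _ _ s _ _ H7 H6 Rmult_comm)].
unfold sturm_rate, Rminus at 5; rewrite Rpower_plus, Rpower_Ropp, Rpower_1 by easy.
unfold plus, mult, scal; simpl; unfold mult; simpl.
unfold bessel_energy; fold (scaled_J mu s).
replace (bessel_theta mu (mu * s)) with (mu * scaled_theta mu s)
  by (unfold scaled_theta; field; lra).
unfold k; field; repeat split; try easy; lra.
Qed.

Lemma filterlim_sturm_0 (mu nu m l' m' : R) (F : (R -> Prop) -> Prop) {FF : Filter F} :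
  0 < mu -> mu < nu ->
  filterlim (fun s => scaled_J mu s) F (locally 0) ->
  filterlim (fun s => scaled_theta mu s) F (locally m) ->
  filterlim (fun s => scaled_J nu s) F (locally l') ->
  filterlim (fun s => scaled_theta nu s) F (locally m') ->
  F (fun s => scaled_J mu s <> 0) ->
  filterlim (sturm mu nu) F (locally 0).
Proof.
intros Hmu Hnu H1 H2 H3 H4 Hnz; unfold sturm.
assert (Hk : 0 < (nu / mu - 1) / 2).
{ assert (1 < nu / mu) by (apply Rlt_div_r; lra); lra. }
apply filterlim_ext with (fun s =>
  (scaled_J nu s * scaled_theta mu s + (- 1) * (scaled_J mu s * scaled_theta nu s))
  * Rpower (scaled_J mu s ^ 2) ((nu / mu - 1) / 2)); [intros; ring|].
replace 0 with ((l' * m + (- 1) * (0 * m')) * 0) by ring.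
eapply filterlim_comp_2; [| |apply (filterlim_mult (K := R_AbsRing))].
- eapply filterlim_comp_2; [| |apply (filterlim_plus (V := R_NormedModule))].
  + eapply filterlim_comp_2; [exact H3|exact H2|].
    apply (filterlim_mult (K := R_AbsRing)).
  + eapply filterlim_comp_2; [apply filterlim_const| |].
    * eapply filterlim_comp_2; [exact H1|exact H4|].
      apply (filterlim_mult (K := R_AbsRing)).
    * apply (filterlim_mult (K := R_AbsRing)).
- apply (filterlim_comp _ _ _ (fun s => scaled_J mu s ^ 2)
           (fun u => Rpower u ((nu / mu - 1) / 2)) _ (at_right 0));
    [|now apply filterlim_Rpower_0].
  assert (Hsq : filterlim (fun s => scaled_J mu s ^ 2) F (locally (0 ^ 2))).
  { apply (filterlim_comp _ _ _ (fun s => scaled_J mu s) (fun u => u ^ 2) _ _ _ H1).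
    apply (ex_derive_continuous (V := R_NormedModule) (fun x : R => x ^ 2)).
    auto_derive; easy. }
  replace (0 ^ 2) with 0 in Hsq by ring.
  intros P HP; change (F (fun s => P (scaled_J mu s ^ 2))).
  generalize (filter_and
    (fun s => 0 < scaled_J mu s ^ 2 -> P (scaled_J mu s ^ 2)) _ (Hsq _ HP) Hnz).
  apply filter_imp.
  intros s [Hs Hs']; apply Hs.
  now apply pow2_pos.
Qed.

Lemma no_zero_same_sign_scaled_J (mu a b s t : R) :
  0 < mu -> 0 <= a -> (forall s, a < s < b -> scaled_J mu s <> 0) ->
  a < s < b -> a < t < b -> 0 < scaled_J mu s * scaled_J mu t.
Proof.
intros Hmu Ha Hn.
assert (H : forall s t, a < s < b -> a < t < b -> s <= t ->
  0 < scaled_J mu s * scaled_J mu t).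
{ intros s' t' Hs Ht Hst.
  apply (no_zero_same_sign (fun s => scaled_J mu s)); [easy| |].
  - intros x Hx; eapply is_derive_continuity_pt; apply is_derive_scaled_J; lra.
  - intros x Hx; apply Hn; lra. }
intros Hs Ht; destruct (Rle_or_lt s t).
- now apply H.
- rewrite Rmult_comm; apply H; lra.
Qed.

Lemma derive_sturm_pos (mu nu a b s0 s : R) :
  0 < mu -> mu < nu -> 0 <= a ->
  (forall s, a < s < b -> scaled_J mu s <> 0) ->
  (forall s, a < s < b -> scaled_J nu s <> 0) ->
  a < s0 < b -> a < s < b ->
  0 < scaled_J mu s0 * scaled_J nu s0
      * (scaled_J mu s * scaled_J nu s * sturm_rate mu nu s).
Proof.
intros Hmu Hnu Ha Hn Hn' Hs0 Hs.
assert (H1 := no_zero_same_sign_scaled_J mu a b s0 s Hmu Ha Hn Hs0 Hs).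
assert (H2 := no_zero_same_sign_scaled_J nu a b s0 s ltac:(lra) Ha Hn' Hs0 Hs).
assert (Hms : 0 < mu * s) by nra.
assert (H3 := bessel_energy_pos mu (mu * s) Hmu Hms).
assert (HJ2 := pow2_pos _ (Hn s Hs)).
match goal with |- 0 < ?A * ?B * (?C * ?D * ?E) =>
  replace (A * B * (C * D * E)) with ((A * C) * (B * D) * E) by ring end.
apply Rmult_lt_0_compat; [now apply Rmult_lt_0_compat|].
unfold sturm_rate; apply Rdiv_lt_0_compat.
- apply Rmult_lt_0_compat; [apply Rmult_lt_0_compat; [lra|apply exp_pos]|easy].
- apply Rmult_lt_0_compat; [nra|easy].
Qed.

Lemma is_derive_sturm_scal (mu nu s c : R) :
  0 < mu -> 0 < nu -> 0 < s -> scaled_J mu s <> 0 ->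
  is_derive (fun s => c * sturm mu nu s) s
    (c * (scaled_J mu s * scaled_J nu s * sturm_rate mu nu s)).
Proof.
intros Hmu Hnu Hs HJ; apply (is_derive_scal _ s c); now apply is_derive_sturm.
Qed.

Lemma filterlim_sturm_scal_0 (mu nu c : R) (F : (R -> Prop) -> Prop) {FF : Filter F} :
  filterlim (sturm mu nu) F (locally 0) ->
  filterlim (fun s => c * sturm mu nu s) F (locally 0).
Proof.
intros H; replace 0 with (c * 0) by ring.
eapply filterlim_comp_2; [apply filterlim_const|exact H|].
apply (filterlim_mult (K := R_AbsRing)).
Qed.

Lemma filterlim_sturm_at_right (mu nu a b : R) :
  0 < mu -> mu < nu -> 0 <= a -> a < b ->
  (a = 0 \/ scaled_J mu a = 0) ->
  (forall s, a < s < b -> scaled_J mu s <> 0) ->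
  filterlim (sturm mu nu) (at_right a) (locally 0).
Proof.
intros Hmu Hnu Ha Hab Ha0 Hn.
destruct (filterlim_scaled_at_right mu a Hmu Ha) as (l & m & H1 & H2 & H3).
destruct (filterlim_scaled_at_right nu a ltac:(lra) Ha) as (l' & m' & H1' & H2' & _).
rewrite (H3 Ha0) in H1.
apply (filterlim_sturm_0 mu nu m l' m'); try easy.
- apply at_right_proper_filter.
- assert (Hd : 0 < b - a) by lra.
  exists (mkposreal _ Hd); intros s Hs Hs'; apply Hn.
  change (Rabs (s - a) < b - a) in Hs; apply Rabs_def2 in Hs; lra.
Qed.

Lemma scaled_J_zero_between (mu nu a b : R) :
  0 < mu -> mu < nu -> 0 <= a -> a < b ->
  (a = 0 \/ scaled_J mu a = 0) -> scaled_J mu b = 0 ->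
  (forall s, a < s < b -> scaled_J mu s <> 0) ->
  exists s, a < s < b /\ scaled_J nu s = 0.
Proof.
intros Hmu Hnu Ha Hab Ha0 Hb0 Hn.
apply Classical_Prop.NNPP; intros Hno.
assert (Hn' : forall s, a < s < b -> scaled_J nu s <> 0)
  by (intros s Hs H; apply Hno; now exists s).
set (s0 := (a + b) / 2).
assert (Hs0 : a < s0 < b) by (unfold s0; lra).
apply (derive_pos_lim_0_ends
   (fun s => scaled_J mu s0 * scaled_J nu s0 * sturm mu nu s)
   (fun s => scaled_J mu s0 * scaled_J nu s0
      * (scaled_J mu s * scaled_J nu s * sturm_rate mu nu s)) a b); [easy| | | |].
- apply filterlim_sturm_scal_0; [apply at_right_proper_filter|].
  now apply filterlim_sturm_at_right with b.
- apply filterlim_sturm_scal_0; [apply at_left_proper_filter|].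
  assert (Hc : forall (f : R -> R) (l : R), is_derive f b l ->
    filterlim f (at_left b) (locally (f b))).
  { intros f l Hf; apply (filterlim_filter_le_1 (F := locally b)).
    - intros P [eps HP]; exists eps; auto.
    - apply (ex_derive_continuous (V := R_NormedModule) f); now exists l. }
  assert (H1 := Hc _ _ (is_derive_scaled_J mu b Hmu ltac:(lra))).
  simpl in H1; rewrite Hb0 in H1.
  apply (filterlim_sturm_0 mu nu (scaled_theta mu b) (scaled_J nu b)
           (scaled_theta nu b)); try easy.
  + apply at_left_proper_filter.
  + apply (Hc _ _ (is_derive_scaled_theta mu b Hmu ltac:(lra))).
  + apply (Hc _ _ (is_derive_scaled_J nu b ltac:(lra) ltac:(lra))).
  + apply (Hc _ _ (is_derive_scaled_theta nu b ltac:(lra) ltac:(lra))).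
  + assert (Hd : 0 < b - a) by lra.
    exists (mkposreal _ Hd); intros s Hs Hs'; apply Hn.
    change (Rabs (s - b) < b - a) in Hs; apply Rabs_def2 in Hs; lra.
- intros s Hs; apply is_derive_sturm_scal; try lra; now apply Hn.
- intros s Hs; now apply derive_sturm_pos with a b.
Qed.

Lemma scaled_theta_ratio_lt (mu nu a b t : R) :
  0 < mu -> mu < nu -> 0 <= a ->
  (a = 0 \/ scaled_J mu a = 0) ->
  (forall s, a < s < b -> scaled_J mu s <> 0) ->
  (forall s, a < s < b -> scaled_J nu s <> 0) ->
  a < t < b ->
  scaled_theta nu t / scaled_J nu t < scaled_theta mu t / scaled_J mu t.
Proof.
intros Hmu Hnu Ha Ha0 Hn Hn' Ht.
assert (H : 0 < scaled_J mu t * scaled_J nu t * sturm mu nu t).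
{ apply (derive_pos_lim_0_pos
   (fun s => scaled_J mu t * scaled_J nu t * sturm mu nu s)
   (fun s => scaled_J mu t * scaled_J nu t
      * (scaled_J mu s * scaled_J nu s * sturm_rate mu nu s)) a t); [easy| | |].
  - apply filterlim_sturm_scal_0; [apply at_right_proper_filter|].
    apply filterlim_sturm_at_right with b; lra || easy.
  - intros s Hs; apply is_derive_sturm_scal; try lra; apply Hn; lra.
  - intros s Hs; apply derive_sturm_pos with a b; lra || easy. }
assert (H1 := Hn t Ht); assert (H2 := Hn' t Ht).
set (p := scaled_theta mu t / scaled_J mu t).
set (p' := scaled_theta nu t / scaled_J nu t).
unfold sturm in H.
replace (scaled_theta mu t) with (p * scaled_J mu t) in H by (unfold p; field; easy).
replace (scaled_theta nu t) with (p' * scaled_J nu t) in H by (unfold p'; field; easy).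
set (K := Rpower (scaled_J mu t ^ 2) ((nu / mu - 1) / 2)) in *.
assert (HK : 0 < K) by apply exp_pos.
replace (_ * _) with
  ((p - p') * ((scaled_J mu t * scaled_J nu t) ^ 2 * K)) in H by ring.
assert (0 <= (scaled_J mu t * scaled_J nu t) ^ 2 * K).
{ apply Rmult_le_pos; [apply pow2_ge_0|lra]. }
apply Rnot_le_lt; intros Hle; nra.
Qed.

Lemma bessel_zero_root (mu : R) (n : nat) :
  0 < mu -> bessel_zero mu n = 0 \/ BesselJ mu (bessel_zero mu n) = 0.
Proof.
intros Hmu; destruct n as [|n]; [now left|right].
now destruct (bessel_zero_spec mu n Hmu) as (_ & H & _).
Qed.

Lemma scaled_zero_interval (mu s : R) (n : nat) :
  0 < mu ->
  bessel_zero mu n / mu < s < bessel_zero mu (S n) / mu ->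
  zero_interval mu n (mu * s).
Proof.
intros Hmu [H1 H2]; apply Rlt_div_l in H1; [|easy]; apply Rlt_div_r in H2; [|easy].
unfold zero_interval; lra.
Qed.

Lemma scaled_J_bessel_zero (mu : R) (n : nat) :
  0 < mu -> bessel_zero mu n / mu = 0 \/ scaled_J mu (bessel_zero mu n / mu) = 0.
Proof.
intros Hmu; unfold scaled_J.
replace (mu * (bessel_zero mu n / mu)) with (bessel_zero mu n) by (field; lra).
destruct (bessel_zero_root mu n Hmu) as [->|H]; [left; unfold Rdiv; ring|now right].
Qed.

Lemma bessel_zero_div_anti (mu nu : R) (n : nat) :
  0 < mu -> mu < nu -> bessel_zero nu n / nu <= bessel_zero mu n / mu.
Proof.
intros Hmu Hnu; induction n as [|n IH]; [unfold bessel_zero; simpl; lra|].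
destruct (bessel_zero_spec mu n Hmu) as ((H0 & H1) & H2 & H3).
destruct (scaled_J_zero_between mu nu (bessel_zero mu n / mu)
  (bessel_zero mu (S n) / mu)) as (s & Hs & HJ); try easy.
- apply Rdiv_le_0_compat; lra.
- unfold Rdiv; apply Rmult_lt_compat_r; [now apply Rinv_0_lt_compat|easy].
- now apply scaled_J_bessel_zero.
- unfold scaled_J; now replace (mu * (bessel_zero mu (S n) / mu))
    with (bessel_zero mu (S n)) by (field; lra).
- intros t Ht; now apply H3, scaled_zero_interval.
- apply Rle_trans with s; [|lra].
  apply Rnot_lt_le; intros Hlt.
  destruct (bessel_zero_spec nu n ltac:(lra)) as (_ & _ & H4).
  apply (H4 (nu * s)); [|exact HJ].
  apply scaled_zero_interval; lra.
Qed.

Lemma bessel_theta_zero_before (nu x : R) (n : nat) :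
  0 < nu -> (1 <= n)%nat ->
  zero_interval nu n x -> BesselJ nu x * bessel_theta nu x <= 0 ->
  exists y, zero_interval nu n y /\ y <= x /\ bessel_theta nu y = 0.
Proof.
intros Hnu Hn Hx Hs.
destruct (bessel_zero_spec nu n Hnu) as (_ & _ & Hnz).
assert (HJx := Hnz x Hx).
assert (Ha : 2 < bessel_zero nu n).
{ apply Rlt_le_trans with (1 := bessel_zero_1_gt nu Hnu).
  now apply bessel_zero_le. }
destruct (bessel_zero_root nu n Hnu) as [H|HJa]; [lra|].
destruct Hx as [Hx1 Hx2].
destruct (MVT_cor2 (BesselJ nu) (fun y => bessel_theta nu y / y) _ _ Hx1)
  as (c & Hc & Hc').
{ intros y Hy; apply is_derive_Reals, is_derive_BesselJ_theta; lra. }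
assert (Hcs : 0 < BesselJ nu x * bessel_theta nu c).
{ rewrite HJa, Rminus_0_r in Hc.
  replace (bessel_theta nu c) with (BesselJ nu x * (c / (x - bessel_zero nu n)))
    by (rewrite Hc; field; lra).
  rewrite <- Rmult_assoc; apply Rmult_lt_0_compat; [nra|].
  apply Rdiv_lt_0_compat; lra. }
apply Classical_Prop.NNPP; intros Hno.
assert (H : 0 < bessel_theta nu c * bessel_theta nu x).
{ apply no_zero_same_sign; [lra| |].
  - intros; apply continuity_pt_bessel_theta; lra.
  - intros y Hy H; apply Hno; exists y; unfold zero_interval; repeat split; lra. }
assert (0 < (BesselJ nu x * bessel_theta nu c)
          * (bessel_theta nu c * bessel_theta nu x))
  by now apply Rmult_lt_0_compat.
assert (0 <= bessel_theta nu c ^ 2) by apply pow2_ge_0.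
nra.
Qed.

Lemma bessel_theta_zero_inside (nu : R) (n : nat) :
  0 < nu -> (1 <= n)%nat ->
  exists y, zero_interval nu n y /\ bessel_theta nu y = 0.
Proof.
intros Hnu Hn.
destruct (bessel_zero_spec nu n Hnu) as ((_ & Hab) & HJb & _).
assert (Ha : 2 < bessel_zero nu n).
{ apply Rlt_le_trans with (1 := bessel_zero_1_gt nu Hnu).
  now apply bessel_zero_le. }
destruct (bessel_zero_root nu n Hnu) as [H|HJa]; [lra|].
destruct (MVT_cor2 (BesselJ nu) (fun y => bessel_theta nu y / y) _ _ Hab)
  as (c & Hc & Hc').
{ intros y Hy; apply is_derive_Reals, is_derive_BesselJ_theta; lra. }
exists c; split; [easy|].
replace (bessel_theta nu c) with
  (bessel_theta nu c / c * (bessel_zero nu (S n) - bessel_zero nu n)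
   * (c / (bessel_zero nu (S n) - bessel_zero nu n))) by (field; lra).
rewrite <- Hc, HJa, HJb; ring.
Qed.

Lemma beta_order_decr (mu nu : R) (n : nat) :
  0 < mu -> mu < nu -> (1 <= n)%nat -> beta nu n < beta mu n.
Proof.
intros Hmu Hnu Hn.
destruct (beta_spec mu n Hmu Hn) as (x & q & Hx & Hphi & _ & Hq & Eq & _).
destruct (beta_spec nu n ltac:(lra) Hn) as (_ & _ & _ & _ & Hmin & _).
destruct (bessel_zero_spec mu n Hmu) as ((H0 & _) & _ & Hnz).
destruct (bessel_zero_spec nu n ltac:(lra)) as ((H0' & Hab') & _ & Hnz').
assert (HJ := Hnz x Hx); destruct Hx as [Hx1 Hx2].
assert (Hanti := bessel_zero_div_anti mu nu n Hmu Hnu).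
set (s := x / mu).
assert (Hsx : mu * s = x) by (unfold s; field; lra).
assert (Hs0 : 0 < s) by (apply Rdiv_lt_0_compat; lra).
assert (Hs : bessel_zero mu n / mu < s < bessel_zero mu (S n) / mu).
{ unfold s, Rdiv; split; apply Rmult_lt_compat_r; try easy;
    now apply Rinv_0_lt_compat. }
assert (Hbeta : beta mu n = 1 + ((q / mu) ^ 2 - 1) / s ^ 2).
{ rewrite <- Hphi, Phi_eq, <- Eq by (easy || lra); unfold s; field; lra. }
clearbody s.
assert (Hs2 : 0 < / s ^ 2) by (apply Rinv_0_lt_compat; nra).
assert (Hqm : 0 < (q / mu) ^ 2) by (apply pow_lt, Rdiv_lt_0_compat; lra).
assert (Hflat : forall y, zero_interval nu n y -> y <= nu * s ->
          bessel_theta nu y = 0 -> beta nu n < beta mu n).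
{ intros y Hy Hys Ht.
  assert (Hy0 : 0 < y) by (destruct Hy; lra).
  apply Rle_lt_trans with (1 := Hmin y Hy).
  rewrite Phi_eq, Ht, Hbeta by (lra || now apply Hnz').
  assert (Hle : / s ^ 2 <= nu ^ 2 / y ^ 2).
  { replace (/ s ^ 2) with (nu ^ 2 * / (nu * s) ^ 2) by (field; lra).
    apply Rmult_le_compat_l; [nra|]; apply Rinv_le_contravar; nra. }
  replace ((0 / BesselJ nu y) ^ 2 - nu ^ 2) with (- nu ^ 2)
    by (field; now apply Hnz').
  unfold Rdiv in *; nra. }
destruct (Rle_or_lt (bessel_zero nu (S n)) (nu * s)) as [Hend|Hend].
{ destruct (bessel_theta_zero_inside nu n ltac:(lra) Hn) as (y & Hy & Ht).
  apply (Hflat y Hy); [destruct Hy; lra|easy]. }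
assert (HX : zero_interval nu n (nu * s)).
{ split; [|easy].
  assert (bessel_zero nu n / nu < s) by lra.
  apply Rlt_div_l in H; lra. }
assert (HJ' := Hnz' _ HX).
set (p := scaled_theta nu s / scaled_J nu s).
assert (Hp : p < q / mu).
{ replace (q / mu) with (scaled_theta mu s / scaled_J mu s)
    by (unfold scaled_theta, scaled_J; rewrite Hsx, Eq; field; split; lra || easy).
  apply (scaled_theta_ratio_lt mu nu (bessel_zero mu n / mu)
           (Rmin (bessel_zero mu (S n) / mu) (bessel_zero nu (S n) / nu))); try easy.
  - apply Rdiv_le_0_compat; lra.
  - now apply scaled_J_bessel_zero.
  - intros t [Ht1 Ht2].
    apply Rmin_Rgt_l in Ht2; apply Hnz, scaled_zero_interval; [easy|]; split; [easy|].
    apply Ht2.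
  - intros t [Ht1 Ht2].
    apply Rmin_Rgt_l in Ht2; apply Hnz', scaled_zero_interval; [lra|].
    split; [lra|]; apply Ht2.
  - split; [easy|]; apply Rmin_glb_lt; [easy|]; apply Rlt_div_r; lra. }
destruct (Rlt_or_le (- (q / mu)) p) as [Hp'|Hp'].
- apply Rle_lt_trans with (1 := Hmin _ HX).
  assert (Hnus : 0 < nu * s) by nra.
  rewrite Phi_eq, Hbeta by (lra || easy).
  replace ((_ ^ 2 - nu ^ 2) / (nu * s) ^ 2) with ((p ^ 2 - 1) / s ^ 2)
    by (unfold p, scaled_theta, scaled_J; field; repeat split; lra || easy).
  assert (p ^ 2 < (q / mu) ^ 2) by nra.
  unfold Rdiv at 1 2; nra.
- destruct (bessel_theta_zero_before nu (nu * s) n ltac:(lra) Hn HX)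
    as (y & Hy & Hys & Ht).
  + replace (bessel_theta nu (nu * s)) with (nu * p * BesselJ nu (nu * s))
      by (unfold p, scaled_theta, scaled_J; field; split; lra || easy).
    assert (0 < q / mu) by (apply Rdiv_lt_0_compat; lra).
    assert (0 <= BesselJ nu (nu * s) ^ 2) by apply pow2_ge_0.
    assert (0 <= nu * - p * BesselJ nu (nu * s) ^ 2)
      by (apply Rmult_le_pos; [nra|easy]).
    lra.
  + now apply (Hflat y Hy).
Qed.

Theorem theorem1 :
  (forall mu : R, 0 < mu ->
     (* beta mu n is a minimum *)
     (forall n : nat, (1 <= n)%nat ->
        (exists x : R, zero_interval mu n x /\ Phi mu x = beta mu n) /\
        (forall x : R, zero_interval mu n x -> beta mu n <= Phi mu x)) /\
     (* 1/(mu+1) < beta_1 < beta_2 < ... < 1, with limit 1 *)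
     1 / (mu + 1) < beta mu 1 /\
     (forall n : nat, (1 <= n)%nat -> beta mu n < beta mu (S n)) /\
     (forall n : nat, (1 <= n)%nat -> beta mu n < 1) /\
     is_lim_seq (beta mu) (Finite 1) /\
     (* the inequality, and its sharpness *)
     (forall n : nat, (1 <= n)%nat ->
        (forall x : R, zero_interval mu n x ->
           (BesselJ mu x) ^ 2 - BesselJ (mu - 1) x * BesselJ (mu + 1) x
             >= beta mu n * (BesselJ mu x) ^ 2) /\
        (forall c : R,
           (forall x : R, zero_interval mu n x ->
              (BesselJ mu x) ^ 2 - BesselJ (mu - 1) x * BesselJ (mu + 1) x
                >= c * (BesselJ mu x) ^ 2) ->
           c <= beta mu n))) /\
  (* monotonicity in the order *)
  (forall n : nat, (1 <= n)%nat ->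
     forall mu nu : R, 0 < mu -> mu < nu -> beta nu n < beta mu n).
Proof.
split; [|intros n Hn mu nu Hmu Hnu; now apply beta_order_decr].
intros mu Hmu.
assert (Hphi : forall n x, zero_interval mu n x ->
  0 < BesselJ mu x ^ 2 /\
  BesselJ mu x ^ 2 - BesselJ (mu - 1) x * BesselJ (mu + 1) x
    = Phi mu x * BesselJ mu x ^ 2).
{ intros n x Hx; destruct (bessel_zero_spec mu n Hmu) as (_ & _ & HJ).
  specialize (HJ x Hx); split; [now apply pow2_pos|].
  unfold Phi; field; easy. }
repeat split.
- destruct (beta_spec mu n Hmu H) as (x & _ & Hx & E & _); now exists x.
- now destruct (beta_spec mu n Hmu H) as (_ & _ & _ & _ & Hmin & _).
- now apply beta_gt.
- intros n Hn; now apply beta_incr.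
- intros n Hn; now apply beta_lt_1.
- now apply is_lim_seq_beta.
- intros x Hx; destruct (beta_spec mu n Hmu H) as (_ & _ & _ & _ & Hmin & _).
  destruct (Hphi n x Hx) as [HJ ->].
  apply Rle_ge, Rmult_le_compat_r; [lra|now apply Hmin].
- intros c Hc; destruct (beta_spec mu n Hmu H) as (x & _ & Hx & <- & _).
  specialize (Hc x Hx); destruct (Hphi n x Hx) as [HJ E].
  rewrite E in Hc; apply Rmult_le_reg_r with (1 := HJ); lra.
Qed.
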